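(* In the setting described in the context, suppose that there is a sequence $\{\mu_t\}_{t\in\mathbb{N}}$ of nonnegative (possibly random) numbers such that, for every $t\in\mathbb{N}$, $$\|y_{t+1}-y_{\mathrm{ss}}(u_t,w_t)\|\le\mu_t,\qquad y_{t+1}=h\big(f(x_t,u_t,w_t),w_t\big).$$ Then, for every even integer $T\ge2$, the iterates generated by the two-point direct search for equilibrium selection satisfy $$\frac{1}{\sqrt{2\pi p}}\sum_{t\in[T]_2}\delta_t\,\mathbb{E}\big[\|\nabla\Phi_t(u_t)\|\big]\le\Phi_0(u_0)-\Phi_{\mathrm{low}}+\frac{L}{4}\sum_{t\in[T]_2}\delta_t^2+2L_{\Psi,y}L_{y_{\mathrm{ss}},w}\sum_{t=0}^{T-1}\|w_{t+1}-w_t\|+2L_{\Psi,y}\sum_{t=0}^{T-1}\mathbb{E}[\mu_t].$$ Consequently, $$\min_{t\in[T]_2}\mathbb{E}\big[\|\nabla\Phi_t(u_t)\|\big]\le\frac{\sqrt{2\pi p}}{\sum_{t\in[T]_2}\delta_t}\Big[\Phi_0(u_0)-\Phi_{\mathrm{low}}+\frac{L}{4}\sum_{t\in[T]_2}\delta_t^2+2L_{\Psi,y}L_{y_{\mathrm{ss}},w}\sum_{t=0}^{T-1}\|w_{t+1}-w_t\|+2L_{\Psi,y}\sum_{t=0}^{T-1}\mathbb{E}[\mu_t]\Big].$$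
   Context: $\mathbb{N}=\{0,1,2,\dots\}$; $\|\cdot\|$ is the Euclidean norm; for even $T\ge2$, $[T]_2=\{0,2,\dots,T-2\}$. Plant: $x_{t+1}=f(x_t,u_t,w_t)$, $y_{t+1}=h(x_{t+1},w_t)$, with state $x_t\in\mathbb{R}^n$, input $u_t\in\mathbb{R}^p$, output $y_t\in\mathbb{R}^q$ and deterministic disturbance sequence $w_t\in\mathbb{R}^r$. There are constants $L_{f,x}\in(0,1)$ and $L_{f,u},L_{f,w},L_{h,x},L_{h,w}\ge0$ such that, for all $x,\bar x,u,\bar u,w,\bar w$: $\|f(x,u,w)-f(\bar x,u,w)\|\le L_{f,x}\|x-\bar x\|$, $\|f(x,u,w)-f(x,\bar u,w)\|\le L_{f,u}\|u-\bar u\|$, $\|f(x,u,w)-f(x,u,\bar w)\|\le L_{f,w}\|w-\bar w\|$, $\|h(x,w)-h(\bar x,w)\|\le L_{h,x}\|x-\bar x\|$, $\|h(x,w)-h(x,\bar w)\|\le L_{h,w}\|w-\bar w\|$. Steady-state maps: $x_{\mathrm{ss}}(u,w)$ is the unique solution of $f(x_{\mathrm{ss}}(u,w),u,w)=x_{\mathrm{ss}}(u,w)$, and $y_{\mathrm{ss}}(u,w)=h(x_{\mathrm{ss}}(u,w),w)$. Set $L_{y_{\mathrm{ss}},w}=L_{h,w}+\frac{L_{h,x}L_{f,w}}{1-L_{f,x}}$. Cost: $\Psi:\mathbb{R}^p\times\mathbb{R}^q\to\mathbb{R}$ is $L_{\Psi,y}$-Lipschitz in its second argument, uniformly in the first.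 The reduced cost is $\Phi_t(u)=\Psi(u,y_{\mathrm{ss}}(u,w_t))$; for every $t$ it is differentiable with $L$-Lipschitz gradient ($L>0$ independent of $t$) and bounded below by $\Phi_{\mathrm{low}}\in\mathbb{R}$ (independent of $t$). The map $u\mapsto\Psi(u,h(f(x,u,w_t),w_t))$ is continuous for every $x\in\mathbb{R}^n$ and $t\in\mathbb{N}$. Two-point direct search for equilibrium selection: given deterministic $u_0\in\mathbb{R}^p$, $x_0\in\mathbb{R}^n$ and a deterministic sequence of positive probing ratios $\delta_t$, for $t=0,2,4,\dots$: apply $u_t$, giving $x_{t+1}=f(x_t,u_t,w_t)$, $y_{t+1}=h(x_{t+1},w_t)$; draw $v_t\sim\mathcal{N}(0,\frac1pI_p)$ independently of all previous draws and set $u_{t+1}=u_t+\delta_tv_t$; apply $u_{t+1}$, giving $x_{t+2}=f(x_{t+1},u_{t+1},w_{t+1})$, $y_{t+2}=h(x_{t+2},w_{t+1})$; set $u_{t+2}=u_{t+1}$ if $\Psi(u_{t+1},y_{t+2})\le\Psi(u_t,y_{t+1})$, and $u_{t+2}=u_t$ otherwise. $\mathbb{E}$ is expectation over the random directions. *)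

(* Defs.v *)
From HB Require Import structures.
From mathcomp Require Import all_boot all_order all_algebra.
From mathcomp Require Import all_classical all_reals all_analysis.

Set Implicit Arguments.
Unset Strict Implicit.
Unset Printing Implicit Defensive.

Import Order.TTheory GRing.Theory Num.Theory.
Import numFieldNormedType.Exports.

Local Open Scope classical_set_scope.
Local Open Scope ring_scope.

Section euclidean.
Context {R : realType}.

(* The library's norm `|x| on row vectors is the sup norm. *)
Definition enorm (m : nat) (x : 'rV[R]_m) : R :=
  Num.sqrt (\sum_(i < m) x 0 i ^+ 2).

Definition elipschitz (m k : nat) (c : R) (g : 'rV[R]_m -> 'rV[R]_k) : Prop :=
  forall a b, enorm (g a - g b) <= c * enorm (a - b).

Definition gradient (m : nat) (F : 'rV[R]_m -> R) (a : 'rV[R]_m) : 'rV[R]_m :=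
  \row_(i < m) 'D_(delta_mx 0 i) F a.

End euclidean.

Section plant.
Context {R : realType} {n p q r : nat}.
Variables (f : 'rV[R]_n -> 'rV[R]_p -> 'rV[R]_r -> 'rV[R]_n)
  (h : 'rV[R]_n -> 'rV[R]_r -> 'rV[R]_q).

Definition steady_state_map (xss : 'rV[R]_p -> 'rV[R]_r -> 'rV[R]_n) : Prop :=
  forall u w, unique (fun x => f x u w = x) (xss u w).

Definition steady_output (xss : 'rV[R]_p -> 'rV[R]_r -> 'rV[R]_n)
    (u : 'rV[R]_p) (w : 'rV[R]_r) : 'rV[R]_q :=
  h (xss u w) w.

Definition reduced_cost (Psi : 'rV[R]_p -> 'rV[R]_q -> R)
    (xss : 'rV[R]_p -> 'rV[R]_r -> 'rV[R]_n) (w : nat -> 'rV[R]_r)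
    (t : nat) (u : 'rV[R]_p) : R :=
  Psi u (steady_output xss u (w t)).

(* One realization of the closed loop, for fixed directions v; only the
   even-indexed directions and probing ratios are used, and y 0 is
   unconstrained because the plant only produces outputs from time 1 on. *)
Record two_point_search (Psi : 'rV[R]_p -> 'rV[R]_q -> R)
    (w : nat -> 'rV[R]_r) (delta : nat -> R)
    (u0 : 'rV[R]_p) (x0 : 'rV[R]_n) (v : nat -> 'rV[R]_p)
    (u : nat -> 'rV[R]_p) (x : nat -> 'rV[R]_n) (y : nat -> 'rV[R]_q)
    : Prop := TwoPointSearch {
  search_input0 : u 0%N = u0;
  search_state0 : x 0%N = x0;
  search_state : forall t, x t.+1 = f (x t) (u t) (w t);
  search_output : forall t, y t.+1 = h (x t.+1) (w t);
  search_probe : forall t, ~~ odd t -> u t.+1 = u t + delta t *: v t;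
  search_select : forall t, ~~ odd t ->
    u t.+2 = if Psi (u t.+1) (y t.+2) <= Psi (u t) (y t.+1)
             then u t.+1 else u t
}.

End plant.

Section gaussian_directions.
Context {R : realType} {d : measure_display} {Omega : measurableType d}.
Variable P : probability Omega R.

(* Row vectors carry no measurable structure in the library; tuples carry the
   product (= Borel) sigma-algebra. *)
Definition row_of_tuple (m : nat) (s : m.-tuple R) : 'rV[R]_m :=
  \row_(i < m) tnth s i.

(* normal_prob takes a standard deviation and is the uniform law on [0, 1] when
   it is 0, hence the explicit Dirac mass. *)
Definition normal_law (m var : R) : set R -> \bar R :=
  if var == 0 then \d_m else normal_prob m (Num.sqrt var).

(* X ~ N(m, S): every linear combination a X^T of the components is univariate
   normal, with mean a m^T and variance a S a^T. *)
Definition normal_vector (k : nat) (m : 'rV[R]_k) (S : 'M[R]_k)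
    (X : {RV P >-> k.-tuple R}) : Prop :=
  forall (a : 'rV[R]_k) (A : set R), measurable A ->
    P [set omega | A ((a *m (row_of_tuple (X omega))^T) 0 0)] =
    normal_law ((a *m m^T) 0 0) ((a *m S *m a^T) 0 0) A.

Definition mutually_independent (I : choiceType) (J : set I)
    (d' : measure_display) (E : measurableType d')
    (X : I -> {RV P >-> E}) : Prop :=
  forall s : seq I, uniq s -> {in s, forall i, J i} ->
  forall A : I -> set E, (forall i, measurable (A i)) ->
    (P (\bigcap_(i in [set` s]) X i @^-1` A i) =
     \prod_(i <- s) P (X i @^-1` A i))%E.

End gaussian_directions.

(* Main.v *)
Require Import Defs.
From HB Require Import structures.
From mathcomp Require Import all_boot all_order all_algebra.
From mathcomp Require Import all_classical all_reals all_analysis.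
From mathcomp Require Import measurable_realfun ring lra.

Set Implicit Arguments.
Unset Strict Implicit.
Unset Printing Implicit Defensive.

Import Order.TTheory GRing.Theory Num.Theory.
Import numFieldNormedType.Exports.

Local Open Scope classical_set_scope.
Local Open Scope ring_scope.

(** The argument is a descent estimate for one exchange of two measurements,
summed along the run.

Fix an even time [t] and write [g] for the gradient of the reduced cost at the
current input, [a] for the probing ratio and [v] for the direction.  The two
measured costs differ from the reduced costs of the two candidate inputs at time
[t] by the transient errors and by one drift of the disturbance.  Keeping the
input with the smaller measured cost therefore keeps, up to those errors, the
better of the two candidates, and the descent lemma shows that the better one
improves on the current input by at least the positive part of
[- (a * dot g v + L / 2 * a ^+ 2 * |v| ^+ 2)] (search_step_decrease).

The expectation of that gain is where the constants come from.  On the half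
space [dot g v < 0] the gain is at least [a * |dot g v|] minus the quadratic
term.  The negative part of [dot g v] has mean [|g| / sqrt (2 pi p)], and by
symmetry the half space carries exactly half of the unit mean of [|v| ^+ 2]; so
the quadratic term costs [L / 4 * a ^+ 2] rather than [L / 2 * a ^+ 2]
(gaussian_expected_decrease).

A Gaussian vector is known here through the laws of its linear forms only.  Such
a law depends on the norm of the coefficients alone, hence every linear form is
symmetric; that this symmetry of one-dimensional laws already decouples
[|v| ^+ 2] from the sign of [dot g v] is proved by differentiating twice under
the expectation (gaussian_sign_decoupling).

The gradient is itself random, but it is a function of the earlier directions.
Independence passes from finitely many coordinates to the generated
sigma-algebra (past_independent), and Fubini's theorem then allows the gradient
to be treated as a constant (independent_integral).  That the iterates are
measurable with respect to the past rests on the continuity of the measured cost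
in the input and on its Lipschitz dependence on the state
(measurable_caratheodory, measurable_search).

In the sum over the even times the reduced costs telescope, because replacing
[Phi t] by [Phi (t + 2)] costs two more drifts.  All the terms involved are
nonnegative once [Philow] is subtracted from the reduced costs, so the whole
computation takes place among nonnegative extended reals, where the expected
errors may be infinite. *)

(** * Euclidean geometry of row vectors *)

Section euclidean_norm.
Context {R : realType}.

Definition dot (m : nat) (a b : 'rV[R]_m) : R := \sum_(i < m) a 0 i * b 0 i.

Variable m : nat.
Implicit Types (a b c : 'rV[R]_m) (k : R).

Lemma enorm_ge0 a : 0 <= enorm a. Proof. exact: sqrtr_ge0. Qed.

Lemma sqr_enorm a : enorm a ^+ 2 = \sum_(i < m) a 0 i ^+ 2.
Proof. by rewrite sqr_sqrtr// sumr_ge0// => i _; rewrite sqr_ge0. Qed.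

Lemma enorm0 : enorm (0 : 'rV[R]_m) = 0.
Proof.
by rewrite /enorm big1 ?sqrtr0// => i _; rewrite mxE expr0n.
Qed.

Lemma enormZ k a : enorm (k *: a) = `|k| * enorm a.
Proof.
rewrite /enorm -sqrtr_sqr -sqrtrM ?sqr_ge0// mulr_sumr; congr Num.sqrt.
by apply: eq_bigr => i _; rewrite mxE exprMn.
Qed.

Lemma enormN a : enorm (- a) = enorm a.
Proof. by rewrite -scaleN1r enormZ normrN1 mul1r. Qed.

Lemma coord_le_enorm a i : `|a 0 i| <= enorm a.
Proof.
rewrite -sqrtr_sqr ler_wsqrtr// (bigD1 i)//= lerDl sumr_ge0// => j _.
exact: sqr_ge0.
Qed.

Lemma enorm_le_norm a : enorm a <= m%:R * `|a|.
Proof.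
have na (i : 'I_m) : `|a 0 i| <= `|a|.
  by rewrite {2}/Num.norm/= mx_normrE; apply: (le_bigmax _ _ (0, i)).
rewrite -(ler_pXn2r (_ : 0 < 2)%N) ?nnegrE ?enorm_ge0 ?mulr_ge0//.
rewrite sqr_enorm exprMn; apply: (@le_trans _ _ (\sum_(i < m) `|a| ^+ 2)).
  by apply: ler_sum => i _; rewrite -real_normK ?num_real// lerXn2r ?nnegrE.
rewrite sumr_const card_ord -[leLHS]mulr_natl ler_wpM2r ?sqr_ge0//.
by rewrite -natrX ler_nat; case: (m) => // k; rewrite expnS leq_pmulr.
Qed.

Lemma enorm_eq0 a : enorm a = 0 -> a = 0.
Proof.
move=> a0; apply/rowP => i; apply/eqP; rewrite mxE -normr_eq0.
by rewrite eq_le normr_ge0 andbT -a0 coord_le_enorm.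
Qed.

Lemma dotDr a b c : dot a (b + c) = dot a b + dot a c.
Proof. by rewrite -big_split; apply: eq_bigr => i _; rewrite mxE mulrDr. Qed.

Lemma dotDl a b c : dot (a + b) c = dot a c + dot b c.
Proof. by rewrite -big_split; apply: eq_bigr => i _; rewrite mxE mulrDl. Qed.

Lemma dotZl k a b : dot (k *: a) b = k * dot a b.
Proof. by rewrite mulr_sumr; apply: eq_bigr => i _; rewrite mxE mulrA. Qed.

Lemma dotZr k a b : dot a (k *: b) = k * dot a b.
Proof. by rewrite mulr_sumr; apply: eq_bigr => i _; rewrite mxE mulrCA. Qed.

Lemma dotNl a b : dot (- a) b = - dot a b.
Proof. by rewrite -scaleN1r dotZl mulN1r. Qed.

Lemma dotBl a b c : dot (a - b) c = dot a c - dot b c.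
Proof. by rewrite dotDl dotNl. Qed.

Lemma dotxx a : dot a a = enorm a ^+ 2.
Proof. by rewrite sqr_enorm; apply: eq_bigr => i _; rewrite expr2. Qed.

Lemma dot_delta i a : dot (delta_mx 0 i) a = a 0 i.
Proof.
rewrite /dot (bigD1 i)//= big1 ?addr0; first by rewrite mxE !eqxx mul1r.
by move=> j /negPf ji; rewrite mxE ji andbF mul0r.
Qed.

Lemma cauchy_schwarz a b : dot a b <= enorm a * enorm b.
Proof.
have [a0|a0] := eqVneq (enorm a) 0.
  rewrite (enorm_eq0 a0) enorm0 mul0r /dot big1// => i _.
  by rewrite mxE mul0r.
have [b0|b0] := eqVneq (enorm b) 0.
  rewrite (enorm_eq0 b0) enorm0 mulr0 /dot big1// => i _.
  by rewrite mxE mulr0.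
have ab0 : 0 < enorm a * enorm b by rewrite mulr_gt0// lt_def ?a0 ?b0 enorm_ge0.
(* expand the square of the vector |b| a - |a| b *)
have : 0 <= enorm (enorm b *: a - enorm a *: b) ^+ 2 by exact: sqr_ge0.
rewrite sqr_enorm.
rewrite (_ : \sum_(i < m) _ = enorm b ^+ 2 * dot a a + enorm a ^+ 2 * dot b b
    - 2 * (enorm a * enorm b) * dot a b); last first.
  rewrite /dot !mulr_sumr -big_split -sumrB/=; apply: eq_bigr => i _.
  by rewrite !mxE; ring.
rewrite !dotxx (_ : _ - _ = 2 * (enorm a * enorm b) *
  (enorm a * enorm b - dot a b)); last by ring.
by rewrite pmulr_rge0 ?subr_ge0// mulr_gt0.
Qed.

Lemma enormD a b : enorm (a + b) <= enorm a + enorm b.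
Proof.
rewrite -(ler_pXn2r (_ : 0 < 2)%N) ?nnegrE ?addr_ge0 ?enorm_ge0//.
rewrite -dotxx dotDl !dotDr !dotxx sqrrD.
have := cauchy_schwarz a b.
have -> : dot b a = dot a b by apply: eq_bigr => i _; rewrite mulrC.
lra.
Qed.

Lemma enorm_distD a b c : enorm (a - c) <= enorm (a - b) + enorm (b - c).
Proof. by rewrite (le_trans _ (enormD _ _))// subrKA. Qed.

End euclidean_norm.

(** * Sensitivity of the steady state *)

Section steady_state.
Context {R : realType} {n p q r : nat}.
Variables (f : 'rV[R]_n -> 'rV[R]_p -> 'rV[R]_r -> 'rV[R]_n).
Variables (h : 'rV[R]_n -> 'rV[R]_r -> 'rV[R]_q).
Variables (Lfx Lfw Lhx Lhw : R) (xss : 'rV[R]_p -> 'rV[R]_r -> 'rV[R]_n).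
Hypothesis hLfx : 0 < Lfx < 1.
Hypothesis hLhx : 0 <= Lhx.
Hypothesis hfx : forall u w, elipschitz Lfx (fun x => f x u w).
Hypothesis hfw : forall x u, elipschitz Lfw (fun w => f x u w).
Hypothesis hhx : forall w, elipschitz Lhx (fun x => h x w).
Hypothesis hhw : forall x, elipschitz Lhw (fun w => h x w).
Hypothesis hxss : steady_state_map f xss.

(** Comparing the two fixed points through [f (xss u w') u w] gives
[|dx| <= Lfx * |dx| + Lfw * |dw|], which is solved for [|dx|]. *)
Lemma steady_state_lipschitz u : elipschitz (Lfw / (1 - Lfx)) (xss u).
Proof.
move=> w w'; have /andP[_ Lfx1] := hLfx.
have fix_ v : f (xss u v) u v = xss u v by have [] := hxss u v.
have := enorm_distD (f (xss u w) u w) (f (xss u w') u w) (f (xss u w') u w').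
have := hfx u w (xss u w) (xss u w'); have := hfw (xss u w') u w w'.
rewrite !fix_ => ? ? ?.
rewrite -mulrAC ler_pdivlMr ?subr_gt0//; lra.
Qed.

Lemma steady_output_lipschitz u :
  elipschitz (Lhw + Lhx * Lfw / (1 - Lfx)) (steady_output h xss u).
Proof.
move=> w w'; rewrite /steady_output.
apply: (le_trans (enorm_distD _ (h (xss u w') w) _)).
rewrite addrC mulrDl lerD ?hhw// (le_trans (hhx _ _ _))//.
by rewrite -!mulrA ler_wpM2l// mulrA steady_state_lipschitz.
Qed.

End steady_state.

(** * The descent lemma *)

Section descent.
Context {R : realType} {m : nat}.
Variables (F : 'rV[R]_m -> R) (L : R).
Hypothesis dF : forall a, differentiable F a.
Hypothesis lipF : elipschitz L (gradient F).

Lemma deriveE_gradient a c : 'D_c F a = dot (gradient F a) c.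
Proof.
rewrite deriveE// {1}(row_sum_delta c) linear_sum; apply: eq_bigr => i _.
by rewrite linearZ/= mxE deriveE// mulrC.
Qed.

Lemma is_derive_line a c s :
  is_derive s (1 : R) (fun s : R => F (a + s *: c)) ('D_c F (a + s *: c)).
Proof.
have quotE : (fun h : R => h^-1 *: (((fun s : R => F (a + s *: c)) \o shift s)
      (h *: (1 : R)) - F (a + s *: c))) =
    (fun h : R => h^-1 *: ((F \o shift (a + s *: c)) (h *: c) - F (a + s *: c))).
  apply/funext => h /=; congr (_ *: (F _ - _)).
  by rewrite [h *: 1]mulr1 scalerDl addrCA addrA.
split; last by rewrite /derive quotE.
by rewrite /derivable quotE; exact: diff_derivable.
Qed.

(** Along the segment from [a] to [a + c] the difference of the two sides is
monotone, since its derivative is controlled by Cauchy-Schwarz and the Lipschitz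
bound on the gradient. *)
Lemma descent a c :
  F (a + c) <= F a + dot (gradient F a) c + L / 2 * enorm c ^+ 2.
Proof.
pose k (s : R) : R :=
  F (a + s *: c) - s * dot (gradient F a) c - s ^+ 2 * (L / 2 * enorm c ^+ 2).
have dk s : is_derive s (1 : R) k
    ('D_c F (a + s *: c) - dot (gradient F a) c - s * (L * enorm c ^+ 2)).
  have dl := is_derive_line a c s.
  rewrite /k; apply: is_derive_eq.
  by rewrite !scaler0 !add0r /GRing.scale/=; field.
have k10 : k 1 <= k 0.
  have dfk z : z \in `]0, 1[ -> derivable k z 1 by move=> _; case: (dk z).
  have k'le0 (z : R) : z \in `]0, 1[ -> derive1 k z <= 0.
    rewrite in_itv/= => /andP[/ltW z0 _].
    rewrite derive1E (derive_val (is_derive := dk z)) deriveE_gradient -dotBl.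
    rewrite subr_le0 (le_trans (cauchy_schwarz _ _))//.
    rewrite expr2 !mulrA ler_wpM2r ?enorm_ge0// (le_trans (lipF _ _))//.
    by rewrite addrC addrA addNr add0r enormZ ger0_norm//; lra.
  apply: (ler0_derive1_le_cc dfk k'le0); rewrite ?in_itv/= ?lexx ?ler01//.
  by apply: derivable_within_continuous => z _; case: (dk z).
by move: k10; rewrite /k scale1r scale0r addr0; lra.
Qed.

End descent.
(** * Measurability of the closed loop *)

Section vector_measurability.
Context {R : realType} {d : measure_display} {Omega : measurableType d}.

(** Borel measurability of a vector-valued function, by coordinates. *)
Definition measurable_row (m : nat) (X : Omega -> 'rV[R]_m) : Prop :=
  forall j, measurable_fun setT (fun omega => X omega 0 j).

Let grid (m k : nat) (z : 'rV[int]_m) : 'rV[R]_m :=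
  \row_j ((z 0 j)%:~R / k.+1%:R).

Let cell (m k : nat) (a : 'rV[R]_m) : 'rV[int]_m :=
  \row_j Num.floor (k.+1%:R * a 0 j).

Let grid_cell m k (a : 'rV[R]_m) : `|a - grid k (cell k a)| <= k.+1%:R^-1.
Proof.
have k0 : 0 < k.+1%:R :> R by rewrite ltr0n.
rewrite {1}/Num.norm/= mx_normrE; apply: bigmax_le => [|[i j] _].
  by rewrite invr_ge0 ler0n.
rewrite !mxE/= (ord1 i) -(ler_pM2l k0) divff ?gt_eqF//.
rewrite -{1}(gtr0_norm k0) -normrM mulrBr mulrCA divff ?gt_eqF// mulr1.
have /andP[fl fu] := floor_itv (k.+1%:R * a 0 j).
by rewrite ger0_norm ?subr_ge0// lerBlDr addrC -[1]/(1%:~R) -intrD ltW.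
Qed.

Let grid_cell_cvg m (a : 'rV[R]_m) : grid k (cell k a) @[k --> \oo] --> a.
Proof.
apply/cvgrPdist_le => e e0; near=> k.
apply: (le_trans (grid_cell _ _)); near: k; near_simpl.
by near do apply: ltW; exact: near_infty_natSinv_lt (PosNum e0).
Unshelve. all: by end_near. Qed.

(** Rounding [X] to a grid of mesh [1 / k.+1] leaves countably many values,
on each of which [G] is measurable by assumption; continuity in the first argument lets
[k] tend to infinity.  This handles functions of two random vectors that are
continuous in each of them without any joint continuity. *)
Lemma measurable_caratheodory m (X : Omega -> 'rV[R]_m)
    (G : 'rV[R]_m -> Omega -> R) :
  measurable_row X -> (forall a, measurable_fun setT (G a)) ->
  (forall omega, continuous (G ^~ omega)) ->
  measurable_fun setT (fun omega => G (X omega) omega).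
Proof.
move=> mX mG cG.
apply: (@measurable_fun_cvg _ _ _ _
  (fun k omega => G (grid k (cell k (X omega))) omega)); last first.
  move=> omega _.
  apply: (@cvg_comp _ _ _ (fun k => grid k (cell k (X omega))) (G ^~ omega)
    _ _ _ (@grid_cell_cvg m (X omega))).
  exact: cG.
move=> k _ Y mY; rewrite setTI.
have -> : (fun omega => G (grid k (cell k (X omega))) omega) @^-1` Y =
    \bigcup_z ([set omega | cell k (X omega) = z] `&` (G (grid k z) @^-1` Y)).
  apply/seteqP; split=> [omega /= GY|omega [z _ [/= <-]//]].
  by exists (cell k (X omega)).
apply: countable_bigcupT_measurable => // z; apply: measurableI; last first.
  by rewrite -[X in measurable X]setTI; exact: mG.
have -> : [set omega | cell k (X omega) = z] =
    \bigcap_(j in [set: 'I_m]) ((fun omega => k.+1%:R * X omega 0 j) @^-1`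
      `[(z 0 j)%:~R, (z 0 j + 1)%:~R[).
  apply/seteqP; split=> [omega /= <- j _|omega /= H].
    by rewrite /= mxE in_itv/= floor_itv.
  apply/rowP => j; rewrite mxE; apply: floor_def.
  by have := H j Logic.I; rewrite /= in_itv.
apply: fin_bigcap_measurable => // j _.
rewrite -[X in measurable X]setTI; apply: measurable_funM => //.
Qed.

Lemma measurable_continuous_row m (X : Omega -> 'rV[R]_m) (g : 'rV[R]_m -> R) :
  measurable_row X -> continuous g -> measurable_fun setT (g \o X).
Proof.
by move=> mX cg; apply: (measurable_caratheodory (G := fun a _ => g a)).
Qed.

Lemma measurable_enorm m (X : Omega -> 'rV[R]_m) :
  measurable_row X -> measurable_fun setT (fun omega => enorm (X omega)).
Proof.
move=> mX; apply: (measurableT_comp (continuous_measurable_fun (@sqrt_continuous R))).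
by apply: measurable_sum => j; apply: measurable_funX; exact: mX.
Qed.

End vector_measurability.

Lemma enorm_continuous {R : realType} (m : nat) (C : R) (g : 'rV[R]_m -> R) :
  (forall a b, `|g a - g b| <= C * enorm (a - b)) -> continuous g.
Proof.
move=> gC a; apply/(@cvgrPdist_le _ _ _ _ (nbhs_filter a)) => e e0.
have K0 : 0 < `|C| * m%:R + 1 :> R by rewrite ltr_wpDl// mulr_ge0.
apply/nbhs_ballP; exists (e / (`|C| * m%:R + 1)) => /=; first exact: divr_gt0.
move=> b; rewrite -ball_normE /= => ab; apply: (le_trans (gC _ _)).
apply: (@le_trans _ _ (`|C| * m%:R * `|a - b|)).
  apply: (@le_trans _ _ (`|C| * enorm (a - b))).
    by rewrite ler_wpM2r ?enorm_ge0// ler_norm.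
  by rewrite -mulrA ler_wpM2l// enorm_le_norm.
apply: (@le_trans _ _ ((`|C| * m%:R + 1) * `|a - b|)).
  by rewrite ler_wpM2r// lerDl.
by rewrite -ler_pdivlMl// mulrC ltW.
Qed.

Section search_measurability.
Context {R : realType} {n p q r : nat}.
Variables (f : 'rV[R]_n -> 'rV[R]_p -> 'rV[R]_r -> 'rV[R]_n).
Variables (h : 'rV[R]_n -> 'rV[R]_r -> 'rV[R]_q).
Variables (w : nat -> 'rV[R]_r) (Lfx Lfu Lhx LPsi : R).
Hypothesis hLhx : 0 <= Lhx.
Hypothesis hfx : forall u w', elipschitz Lfx (fun x => f x u w').
Hypothesis hfu : forall x w', elipschitz Lfu (fun u => f x u w').
Hypothesis hhx : forall w', elipschitz Lhx (fun x => h x w').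
Variable Psi : 'rV[R]_p -> 'rV[R]_q -> R.
Hypothesis hLPsi : 0 <= LPsi.
Hypothesis hPsi : forall u y y', `|Psi u y - Psi u y'| <= LPsi * enorm (y - y').
Hypothesis hcont :
  forall x t, continuous (fun u => Psi u (h (f x u (w t)) (w t))).
Context {d : measure_display} {Omega : measurableType d}.

Lemma measurable_next_state (x : Omega -> 'rV[R]_n) (u : Omega -> 'rV[R]_p) t :
  measurable_row x -> measurable_row u ->
  measurable_row (fun omega => f (x omega) (u omega) (w t)).
Proof.
have coord_lip k l C (g : 'rV[R]_k -> 'rV[R]_l) j :
    elipschitz C g -> continuous (fun a => g a 0 j).
  move=> lg; apply: (@enorm_continuous _ _ C) => a b.
  by have := coord_le_enorm (g a - g b) j; rewrite !mxE => /le_trans; exact.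
move=> mx mu j.
apply: (measurable_caratheodory (G := fun a omega => f a (u omega) (w t) 0 j)) => //.
- move=> a; apply: (measurable_continuous_row (g := fun b => f a b (w t) 0 j)) => //.
  exact: coord_lip (hfu a (w t)).
- by move=> omega; exact: coord_lip (hfx (u omega) (w t)).
Qed.

Lemma measurable_cost (x : Omega -> 'rV[R]_n) (u : Omega -> 'rV[R]_p) t :
  measurable_row x -> measurable_row u ->
  measurable_fun setT
    (fun omega => Psi (u omega) (h (f (x omega) (u omega) (w t)) (w t))).
Proof.
move=> mx mu.
apply: (measurable_caratheodory
  (G := fun a omega => Psi (u omega) (h (f a (u omega) (w t)) (w t)))) => //.
- move=> a.
  exact: (measurable_continuous_row (g := fun b => Psi b (h (f a b (w t)) (w t)))).
- move=> omega; apply: (@enorm_continuous _ _ (LPsi * (Lhx * Lfx))) => a b.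
  rewrite (le_trans (hPsi _ _ _))// -!mulrA ler_wpM2l//.
  by rewrite (le_trans (hhx _ _ _))// ler_wpM2l// hfx.
Qed.

(** The sample space is arbitrary, so that the lemma also applies to the
sigma-algebra generated by the directions drawn before [k.*2]. *)
Lemma measurable_search (delta : nat -> R) (u0 : 'rV[R]_p) (x0 : 'rV[R]_n)
    (v : nat -> Omega -> 'rV[R]_p) (u : nat -> Omega -> 'rV[R]_p)
    (x : nat -> Omega -> 'rV[R]_n) (y : nat -> Omega -> 'rV[R]_q) :
  (forall omega, two_point_search f h Psi w delta u0 x0 (v^~ omega)
    (u^~ omega) (x^~ omega) (y^~ omega)) ->
  forall k, (forall s, (s < k)%N -> measurable_row (v s.*2)) ->
  measurable_row (u k.*2) /\ measurable_row (x k.*2).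
Proof.
move=> search; elim=> [|k IH] mv.
  split=> j.
  - rewrite (_ : (fun _ => _) = cst (u0 0 j)) ?double0//.
    by apply/funext => omega; rewrite (search_input0 (search omega)).
  - rewrite (_ : (fun _ => _) = cst (x0 0 j)) ?double0//.
    by apply/funext => omega; rewrite (search_state0 (search omega)).
have {IH}[mu mx] := IH (fun s sk => mv s (ltnW sk)).
have ek : ~~ odd k.*2 by rewrite odd_double.
have mv_ := mv k (ltnSn k).
have mu1 : measurable_row (u k.*2.+1).
  move=> j; rewrite (_ : (fun _ => _) =
      (fun omega => u k.*2 omega 0 j + delta k.*2 * v k.*2 omega 0 j)).
    by apply: measurable_funD; [exact: mu|apply: measurable_funM].
  by apply/funext => omega; rewrite (search_probe (search omega))// !mxE.
have mx1 : measurable_row (x k.*2.+1).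
  rewrite (_ : x _ = (fun omega => f (x k.*2 omega) (u k.*2 omega) (w k.*2))).
    exact: measurable_next_state.
  by apply/funext => omega; rewrite (search_state (search omega)).
rewrite doubleS; split; last first.
  rewrite (_ : x _ =
      (fun omega => f (x k.*2.+1 omega) (u k.*2.+1 omega) (w k.*2.+1))).
    exact: measurable_next_state.
  by apply/funext => omega; rewrite (search_state (search omega)).
pose c t omega := Psi (u t omega) (h (f (x t omega) (u t omega) (w t)) (w t)).
move=> j; rewrite (_ : (fun _ => _) = (fun omega =>
    if c k.*2.+1 omega <= c k.*2 omega
    then u k.*2.+1 omega 0 j else u k.*2 omega 0 j)).
  apply: measurable_fun_ifT; [|exact: mu1|exact: mu].
  by apply: measurable_fun_ler; exact: measurable_cost.
apply/funext => omega; rewrite (search_select (search omega))//.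
rewrite !(search_output (search omega)) !(search_state (search omega)) /c.
by rewrite -!(search_state (search omega)); case: ifP.
Qed.

End search_measurability.

(** * Gaussian directions *)

Section density.
Local Open Scope ereal_scope.
Context {d : measure_display} {T : measurableType d} {R : realType}.
Variables (mu nu : {measure set T -> \bar R}) (g : T -> R).
Hypothesis g0 : forall x, (0 <= g x)%R.
Hypothesis mg : measurable_fun setT g.
Hypothesis nuE : forall A, measurable A -> nu A = \int[mu]_(x in A) (g x)%:E.

Import HBNNSimple.

Let integral_density_nnsfun (s : {nnsfun T >-> R}) :
  \int[nu]_x (s x)%:E = \int[mu]_x (s x * g x)%:E.
Proof.
have ms r : measurable (s @^-1` [set r]) by [].
transitivity (\sum_(r \in range s) \int[nu]_x (r * \1_(s @^-1` [set r]) x)%:E).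
  rewrite -ge0_integral_fsum//.
  - by apply: eq_integral => x _; rewrite fimfunE -fsumEFin.
  - by move=> r; apply/measurable_EFinP; apply: measurable_funM => //.
  - by move=> r x _; rewrite EFinM nnfun_muleindic_ge0.
transitivity (\sum_(r \in range s)
    \int[mu]_x (r * \1_(s @^-1` [set r]) x * g x)%:E).
  apply: eq_fsbigr => r /[!inE] -[x _ <-]; have sx0 : (0 <= s x)%R by [].
  under eq_integral do rewrite EFinM.
  under [RHS]eq_integral do rewrite -mulrA EFinM.
  rewrite !ge0_integralZl_EFin//; first last.
  - by apply/measurable_EFinP; exact: measurable_indic.
  - by apply/measurable_EFinP; apply: measurable_funM => //.
  - by move=> y _; rewrite lee_fin mulr_ge0.
  rewrite integral_indic// setIT nuE// [in LHS]integral_mkcond.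
  congr (_ * _); apply: eq_integral => y _; rewrite patchE indicE.
  by case: ifP => _; rewrite ?mul1r ?mul0r.
rewrite -ge0_integral_fsum//.
- apply: eq_integral => x _; rewrite fimfunE EFinM -fsumEFin//.
  rewrite ge0_mule_fsuml//.
  by move=> r; rewrite EFinM nnfun_muleindic_ge0.
- move=> r; apply/measurable_EFinP; apply: measurable_funM => //.
  by apply: measurable_funM => //.
- move=> r x _; rewrite EFinM mule_ge0 ?lee_fin//.
  by have := nnfun_muleindic_ge0 s r x; rewrite -EFinM lee_fin.
Qed.

Lemma integral_density (phi : T -> R) : (forall x, (0 <= phi x)%R) ->
  measurable_fun setT phi ->
  \int[nu]_x (phi x)%:E = \int[mu]_x (phi x * g x)%:E.
Proof.
move=> phi0 mphi.
have mphiE : measurable_fun setT (EFin \o phi) by exact/measurable_EFinP.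
pose s := nnsfun_approx measurableT mphiE.
have s_phi x : (s n x)%:E @[n --> \oo] --> (phi x)%:E.
  by apply: (cvg_nnsfun_approx measurableT mphiE) => // y _; rewrite lee_fin.
have nd_s x a b : (a <= b)%N -> (s a x <= s b x)%R.
  by move=> ab; have /lefP := nd_nnsfun_approx measurableT mphiE ab; exact.
transitivity (limn (fun n => \int[nu]_x (s n x)%:E)).
  rewrite -monotone_convergence//.
  - by apply: eq_integral => x _; apply/esym/cvg_lim.
  - by move=> n; exact/measurable_EFinP.
  - by move=> n x _; rewrite lee_fin.
  - by move=> x _ a b ab; rewrite lee_fin nd_s.
under eq_fun do rewrite integral_density_nnsfun.
rewrite -monotone_convergence//.
- apply: eq_integral => x _; apply/cvg_lim => //.
  rewrite [X in _ --> X]EFinM; under eq_fun do rewrite EFinM.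
  exact: cvgeZr.
- by move=> n; apply/measurable_EFinP; exact: measurable_funM.
- by move=> n x _; rewrite lee_fin mulr_ge0.
- by move=> x _ a b ab; rewrite lee_fin ler_wpM2r// nd_s.
Qed.

End density.

Section normal_moments.
Context {R : realType}.
Variable s : R.
Hypothesis s0 : 0 < s.

Let sN0 : s != 0. Proof. by rewrite gt_eqF. Qed.

Let integral_normal (phi : R -> R) : (forall x, 0 <= phi x) ->
  measurable_fun setT phi ->
  (\int[normal_prob 0 s]_x (phi x)%:E =
   \int[lebesgue_measure]_x (phi x * normal_pdf 0 s x)%:E)%E.
Proof.
move=> phi0 mphi; apply: integral_density => //.
- by move=> x; exact: normal_pdf_ge0.
- exact: measurable_normal_pdf.
Qed.

Let pdfE (x : R) :
  normal_pdf 0 s x = (s * Num.sqrt (2 * pi))^-1 * expR (- x ^+ 2 / (s ^+ 2 *+ 2)).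
Proof.
rewrite normal_pdfE// /normal_peak /normal_fun subr0; congr (_^-1 * _).
rewrite -mulrnAr sqrtrM ?sqr_ge0// sqrtr_sqr gtr0_norm// -mulr_natl //.
Qed.

Let pdf_primitive (x : R) :
  is_derive x 1 (fun x => - s ^+ 2 * normal_pdf 0 s x) (x * normal_pdf 0 s x).
Proof.
have -> : (fun x => - s ^+ 2 * normal_pdf 0 s x) = (fun x : R =>
    (- s ^+ 2 * (s * Num.sqrt (2 * pi))^-1) * expR (x ^+ 2 * (- (s ^+ 2 *+ 2)^-1))).
  by apply/funext => y; rewrite pdfE mulrA; congr (_ * expR _); rewrite mulNr mulrN.
rewrite pdfE; apply: is_derive_eq.
rewrite /GRing.scale/= !mulr1 mulrN !mulNr.
have ? : Num.sqrt (2 * pi) != 0 :> R by rewrite gt_eqF// sqrtr_gt0 mulr_gt0// pi_gt0.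
by field; apply/andP; split.
Qed.

Lemma normal_prob_positive_part :
  (\int[normal_prob 0 s]_x (Num.max x 0)%:E = (s / Num.sqrt (2 * pi))%:E)%E.
Proof.
rewrite integral_normal; first last.
- exact: measurable_maxr.
- by move=> x; rewrite le_max lexx orbT.
transitivity (\int[lebesgue_measure]_(x in `[0%R, +oo[) (x * normal_pdf 0 s x)%:E)%E.
  rewrite [RHS]integral_mkcond; apply: eq_integral => x _.
  rewrite patchE mem_setE in_itv/= andbT /Num.max.
  by case: ltrgtP; rewrite ?mul0r//; move=> ->; rewrite mul0r.
have cpdf : continuous (normal_pdf 0 s) by exact: continuous_normal_pdf.
have pdf_oo : normal_pdf 0 s x @[x --> +oo] --> (0 : R).
  rewrite (_ : normal_pdf 0 s = fun x : R =>
      (s * Num.sqrt (2 * pi))^-1 * gauss_fun (x * (s * Num.sqrt 2)^-1)).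
    rewrite -[X in _ --> X](mulr0 (s * Num.sqrt (2 * pi))^-1).
    apply: cvgM; first exact: cvg_cst.
    apply: (cvg_comp _ gauss_fun _ (@cvg_gauss_fun R)).
    by apply: gt0_cvgMly => //; rewrite invr_gt0 mulr_gt0// sqrtr_gt0.
  apply/funext => x; rewrite pdfE /gauss_fun; congr (_ * expR _).
  by rewrite mulNr exprMn exprVn exprMn sqr_sqrtr// mulr_natr.
rewrite (@ge0_continuous_FTC2y _ _ (fun x => - s ^+ 2 * normal_pdf 0 s x) 0 0).
- rewrite -EFinB sub0r mulNr opprK pdfE expr0n oppr0 mul0r expR0 mulr1.
  by rewrite invfM mulrA expr2 mulfK.
- by move=> x x0; rewrite mulr_ge0// normal_pdf_ge0.
- apply: continuous_subspaceT => x; apply: cvgM; first exact: cvg_id.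
  exact: cpdf.
- rewrite -[X in _ --> X](mulr0 (- s ^+ 2)); apply: cvgM; first exact: cvg_cst.
  exact: pdf_oo.
- by move=> x _; case: (pdf_primitive x).
- apply: cvg_at_right_filter; apply: cvgM; first exact: cvg_cst.
  exact: cpdf.
- by move=> x _; rewrite derive1E (derive_val (is_derive := pdf_primitive x)).
Qed.

(** The bound is extracted from the normalization of the density at every scale:
comparing the scales [s] and [t * s] and letting [t] decrease to 1 amounts to
differentiating the total mass with respect to the scale. *)
Lemma normal_prob_second_moment :
  (\int[normal_prob 0 s]_x (x ^+ 2)%:E <= (s ^+ 2)%:E)%E.
Proof.
set M := (X in (X <= _)%E).
have M0 : (0 <= M)%E by apply: integral_ge0 => x _; rewrite lee_fin sqr_ge0.
(* by e ^ z >= 1 + z, t times the density at scale t s is at least the density at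
   scale s times an affine function of x ^+ 2 *)
have Mle (t : R) : 1 < t ->
    (1 + ((t ^+ 2 - 1) / (2 * t ^+ 2 * s ^+ 2))%:E * M <= t%:E)%E.
  move=> t1; set c := _ / _.
  have t0 : 0 < t by rewrite (lt_trans ltr01).
  have c0 : 0 <= c.
    apply: divr_ge0; last by rewrite !mulr_ge0// ltW.
    by rewrite subr_ge0 exprn_ege1// ltW.
  have mpdf z : measurable_fun setT (normal_pdf (0 : R) z).
    exact: measurable_normal_pdf.
  rewrite /M integral_normal; first last.
  - exact: measurable_funX.
  - by move=> x; exact: sqr_ge0.
  rewrite -(integral_normal_pdf 0 s) -ge0_integralZl_EFin//; first last.
  - by apply/measurable_EFinP; apply: measurable_funM;
      [exact: measurable_funX|exact: mpdf].
  - by move=> x _; rewrite lee_fin mulr_ge0 ?sqr_ge0 ?normal_pdf_ge0.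
  rewrite -ge0_integralD//; first last.
  - apply/measurable_EFinP; apply: measurable_funM => //; apply: measurable_funM;
      [exact: measurable_funX|exact: mpdf].
  - by move=> x _; rewrite lee_fin mulr_ge0// mulr_ge0 ?sqr_ge0 ?normal_pdf_ge0.
  - by apply/measurable_EFinP; exact: mpdf.
  - by move=> x _; rewrite lee_fin normal_pdf_ge0.
  rewrite -[leRHS]mule1 -(integral_normal_pdf 0 (t * s)).
  rewrite -ge0_integralZl_EFin//; first last.
  - exact: ltW.
  - by apply/measurable_EFinP; exact: mpdf.
  - by move=> x _; rewrite lee_fin normal_pdf_ge0.
  apply: ge0_le_integral => //.
  - by move=> x _; rewrite lee_fin addr_ge0 ?normal_pdf_ge0// mulr_ge0// mulr_ge0 ?sqr_ge0
      ?normal_pdf_ge0.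
  - apply/measurable_EFinP; apply: measurable_funD; first exact: mpdf.
    apply: measurable_funM => //; apply: measurable_funM;
      [exact: measurable_funX|exact: mpdf].
  - by apply/measurable_EFinP; apply: measurable_funM => //; exact: mpdf.
  move=> x _; rewrite lee_fin.
  have tN0 : t != 0 by rewrite gt_eqF.
  have ts0 : t * s != 0 by rewrite mulf_neq0.
  have -> : t * normal_pdf 0 (t * s) x =
      normal_pdf 0 s x * expR (c * x ^+ 2).
    rewrite pdfE -mulrA -expRD normal_pdfE// /normal_peak /normal_fun subr0.
    rewrite -mulrnAr sqrtrM ?sqr_ge0// sqrtr_sqr gtr0_norm ?mulr_gt0//.
    rewrite !mulr_natl.
    have ? : Num.sqrt (pi *+ 2) != 0 :> R.
      by rewrite gt_eqF// sqrtr_gt0 mulrn_wgt0// pi_gt0.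
    rewrite (_ : - x ^+ 2 / (s ^+ 2 *+ 2) + c * x ^+ 2 =
      - x ^+ 2 / ((t * s) ^+ 2 *+ 2)); last first.
      by rewrite /c; field; rewrite sN0 tN0.
    by field; apply/and3P; split.
  have -> : normal_pdf 0 s x + c * (x ^+ 2 * normal_pdf 0 s x) =
    normal_pdf 0 s x * (1 + c * x ^+ 2) by ring.
  by rewrite ler_wpM2l ?normal_pdf_ge0// expR_ge1Dx.
(* the resulting bound 2 s ^+ 2 t ^+ 2 / (t + 1) on M tends to s ^+ 2 as t
   decreases to 1 *)
case: M M0 Mle => [m| |//] m0 Mle; last first.
  have := Mle 2 (ltr1n _ 2); rewrite gt0_muley ?addey//.
  rewrite lte_fin divr_gt0 ?mulr_gt0 ?exprn_gt0//.
  by rewrite expr2; lra.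
rewrite lee_fin; apply/ler_addgt0Pr => e e0.
pose a := Num.min 1 (e / (3 * s ^+ 2)).
have a0 : 0 < a by rewrite lt_min ltr01/= divr_gt0// mulr_gt0// exprn_gt0.
have a1 : a <= 1 by rewrite ge_min lexx.
have ae : 3 * s ^+ 2 * a <= e.
  by rewrite mulrC -ler_pdivlMr ?mulr_gt0 ?exprn_gt0// ge_min lexx orbT.
have := Mle (1 + a); rewrite ltrDl a0 => /(_ isT).
rewrite -EFinM -EFinD lee_fin lerD2l mulrAC ler_pdivrMr; last first.
  by rewrite !mulr_gt0 ?exprn_gt0// addr_gt0.
rewrite (_ : _ - 1 = a * (2 + a)); last by ring.
rewrite -!mulrA ler_pM2l// => H.
have s2 : 0 < s ^+ 2 by rewrite exprn_gt0.
have : (2 + a) * m <= (2 + a) * (s ^+ 2 * (1 + 3 * a)).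
  apply: (le_trans H); rewrite (mulrC _ (s ^+ 2)) !(mulrCA _ (s ^+ 2)).
  by rewrite ler_pM2l//; nra.
rewrite ler_pM2l; last by rewrite addr_gt0.
by move=> /le_trans; apply; nra.
Qed.

End normal_moments.

(** The value 1/2 at 0 makes [heaviside x + heaviside (- x) = 1] hold everywhere,
so that events of the form [dot g v = 0] need no separate treatment. *)
Definition heaviside {R : realType} (x : R) : R :=
  if 0 < x then 1 else if x == 0 then 2^-1 else 0.

Lemma heaviside_ge0 {R : realType} (x : R) : 0 <= heaviside x.
Proof.
by rewrite /heaviside; case: ifP => // _; case: ifP => // _; rewrite invr_ge0.
Qed.

Lemma measurable_heaviside {R : realType} : measurable_fun setT (@heaviside R).
Proof.
apply: measurable_fun_ifT => //; first exact: measurable_fun_ltr.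
by apply: measurable_fun_ifT => //; exact: measurable_fun_eqr.
Qed.

Section one_sided_square.
Context {R : realType}.
Implicit Types b x y : R.

Definition sqr_pos (x : R) : R := Num.max x 0 ^+ 2.

Definition second_diff (b x y : R) : R :=
  sqr_pos (x + b * y) + sqr_pos (x - b * y) - 2 * sqr_pos x.

Lemma sqr_pos_ge0 x : 0 <= sqr_pos x. Proof. exact: sqr_ge0. Qed.

Lemma sqr_posE (x : R) : 0 <= x -> sqr_pos x = x ^+ 2.
Proof. by move=> x0; rewrite /sqr_pos max_l. Qed.

Lemma sqr_pos_neg (x : R) : x <= 0 -> sqr_pos x = 0.
Proof. by move=> x0; rewrite /sqr_pos max_r// expr0n. Qed.

Lemma measurable_sqr_pos : measurable_fun setT sqr_pos.
Proof. by apply: measurable_funX; exact: measurable_maxr. Qed.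

Lemma second_diff_bounds b x y : 0 <= second_diff b x y <= 2 * (b * y) ^+ 2.
Proof.
rewrite /second_diff; move: (b * y) => z.
have psiP u : (0 <= u /\ sqr_pos u = u ^+ 2) \/ (u <= 0 /\ sqr_pos u = 0).
  have [u0|/ltW u0] := leP 0 u; first by left; rewrite sqr_posE.
  by right; rewrite sqr_pos_neg.
by have [[? ->]|[? ->]] := psiP (x + z); have [[? ->]|[? ->]] := psiP (x - z);
  have [[? ->]|[? ->]] := psiP x; apply/andP; split; nra.
Qed.

(** Both shifted points lie on the same side of 0 as [x]; at [x = 0] the two shifts
contribute one square together, which is where the value 1/2 comes from. *)
Lemma second_diffE b x y : x = 0 \/ `|b * y| <= `|x| ->
  second_diff b x y = 2 * (b * y) ^+ 2 * heaviside x.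
Proof.
rewrite /second_diff /heaviside; move: (b * y) => z; case: (ltrgtP 0 x) => [x0|x0|<-] H.
- have zx : `|z| <= x by case: H => [|]; [lra|rewrite (gtr0_norm x0)].
  move: zx; rewrite ler_norml => /andP[? ?].
  by rewrite !sqr_posE; lra || ring.
- have zx : `|z| <= - x by case: H => [|]; [lra|rewrite (ltr0_norm x0)].
  move: zx; rewrite ler_norml => /andP[? ?].
  by rewrite !sqr_pos_neg; lra || ring.
- rewrite add0r sub0r (sqr_pos_neg (lexx 0)) mulr0 subr0 -mulrA mulrCA divff// mulr1.
  have [z0|/ltW z0] := leP 0 z.
    by rewrite sqr_posE// sqr_pos_neg ?addr0// oppr_le0.
  by rewrite sqr_pos_neg// sqr_posE ?add0r ?sqrrN// oppr_ge0.
Qed.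

Lemma second_diff_cvg x y :
  second_diff k.+1%:R^-1 x y * k.+1%:R ^+ 2 @[k --> \oo] -->
  2 * y ^+ 2 * heaviside x.
Proof.
have E k : x = 0 \/ `|k.+1%:R^-1 * y| <= `|x| ->
    second_diff k.+1%:R^-1 x y * k.+1%:R ^+ 2 = 2 * y ^+ 2 * heaviside x.
  move=> H; rewrite second_diffE// exprMn.
  by field; rewrite addrC natr1 pnatr_eq0.
have [x0|x0] := eqVneq x 0.
  by apply: cvg_near_cst; apply: nearW => k; apply: E; left.
have e0 : 0 < `|x| / (`|y| + 1) by rewrite divr_gt0 ?normr_gt0// ltr_wpDl.
apply: cvg_near_cst; near=> k; apply/E; right.
have ke : k.+1%:R^-1 < `|x| / (`|y| + 1).
  by near: k; exact: near_infty_natSinv_lt (PosNum e0).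
rewrite normrM ger0_norm// (@le_trans _ _ (k.+1%:R^-1 * (`|y| + 1)))//.
  by rewrite ler_wpM2l// lerDl.
by rewrite -ler_pdivlMr ?ltr_wpDl// ltW.
Unshelve. all: by end_near. Qed.

End one_sided_square.

Section gaussian_direction.
Context {R : realType} {d : measure_display} {Omega : measurableType d}.
Variable P : probability Omega R.
Context {p : nat} (hp : (0 < p)%N).
Variable V : {RV P >-> p.-tuple R}.
Hypothesis hV : normal_vector 0 (p%:R^-1)%:M V.
Implicit Types (a g : 'rV[R]_p).

Local Notation Z a := (fun omega => dot a (row_of_tuple (V omega))).

Lemma measurable_linear_form a : measurable_fun setT (Z a).
Proof.
apply: measurable_sum => i; apply: measurable_funM => //.
under eq_fun do rewrite mxE.
by apply: (measurableT_comp (measurable_tnth i)).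
Qed.

Let p0 : 0 < p%:R :> R. Proof. by rewrite ltr0n. Qed.

(** Typing the linear form in [measurableTypeR R] makes its law and the normal law
measures on the same measurable type. *)
Let measurable_ZB a : measurable_fun setT (Z a : Omega -> measurableTypeR R).
Proof. exact: measurable_linear_form. Qed.

Let Zm a : {mfun Omega >-> measurableTypeR R} :=
  HB.pack (Z a) (isMeasurableFun.Build _ _ _ _ _ (measurable_ZB a)).

Let distribution_Z a A : measurable A ->
  distribution P (Zm a) A = normal_law 0 (p%:R^-1 * enorm a ^+ 2) A.
Proof.
move=> mA; have := hV a mA.
rewrite trmx0 mulmx0 mxE mul_mx_scalar -scalemxAl mxE => H.
have -> : p%:R^-1 * enorm a ^+ 2 = p%:R^-1 * (a *m a^T) 0 0.
  by rewrite -dotxx mxE; congr (_ * _); apply: eq_bigr => i _; rewrite !mxE.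
rewrite -H; congr (P _); apply/funext => omega /=; congr (A _).
by rewrite mxE; apply: eq_bigr => i _; rewrite !mxE.
Qed.

Let integral_Z a (phi : R -> R) : measurable_fun setT phi ->
  (forall x, 0 <= phi x) ->
  (\int[P]_omega (phi (Z a omega))%:E =
   \int[distribution P (Zm a)]_x (phi x)%:E)%E.
Proof.
move=> mphi phi0; rewrite ge0_integral_distribution//; exact/measurable_EFinP.
Qed.

Let integral_Z_normal a (phi : R -> R) : a != 0 -> measurable_fun setT phi ->
  (forall x, 0 <= phi x) ->
  (\int[P]_omega (phi (Z a omega))%:E =
   \int[normal_prob 0 (enorm a / Num.sqrt p%:R)]_x (phi x)%:E)%E.
Proof.
move=> a0 mphi phi0; rewrite integral_Z//.
have ea : enorm a != 0 by apply: contra_neq a0 => /enorm_eq0.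
have lawE : normal_law 0 (p%:R^-1 * enorm a ^+ 2) =
    normal_prob 0 (enorm a / Num.sqrt p%:R).
  rewrite /normal_law mulf_eq0 invr_eq0 (gt_eqF p0) sqrf_eq0 (negPf ea)/=.
  congr (normal_prob _ _).
  by rewrite mulrC sqrtrM ?sqr_ge0// sqrtr_sqr sqrtrV// ger0_norm// enorm_ge0.
apply: eq_measure_integral => A mA _.
by apply: (etrans (distribution_Z a mA)); rewrite lawE.
Qed.

(** The law of a linear form depends on its coefficients only through their norm,
and [- dot a v] is the linear form with coefficients [- a]. *)
Lemma gaussian_linear_form_symmetric a (phi : R -> R) :
  measurable_fun setT phi -> (forall x, 0 <= phi x) ->
  (\int[P]_omega (phi (Z a omega))%:E = \int[P]_omega (phi (- Z a omega))%:E)%E.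
Proof.
move=> mphi phi0.
under [RHS]eq_integral do rewrite -dotNl.
rewrite !integral_Z//; apply: eq_measure_integral => A mA _.
have := distribution_Z (- a) mA; rewrite enormN => HN.
exact: etrans (distribution_Z a mA) (esym HN).
Qed.

Lemma gaussian_linear_form_sqr a :
  (\int[P]_omega (Z a omega ^+ 2)%:E <= (enorm a ^+ 2 / p%:R)%:E)%E.
Proof.
have [->|a0] := eqVneq a 0.
  rewrite enorm0 expr0n mul0r integral0_eq// => omega _.
  by rewrite -[0](scale0r 0) dotZl mul0r expr0n.
rewrite (integral_Z_normal a0 (phi := fun x => x ^+ 2))//; last first.
  by move=> x; exact: sqr_ge0.
have ea : 0 < enorm a.
  by rewrite lt_def enorm_ge0 andbT; apply: contra_neq a0 => /enorm_eq0.
have s0 : 0 < enorm a / Num.sqrt p%:R by rewrite divr_gt0// sqrtr_gt0.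
apply: (le_trans (normal_prob_second_moment s0)).
by rewrite lee_fin exprMn exprVn (@sqr_sqrtr _ p%:R)// ltW.
Qed.

Lemma gaussian_linear_form_positive_part a :
  (\int[P]_omega (Num.max (Z a omega) 0)%:E =
   (enorm a / Num.sqrt (2 * pi * p%:R))%:E)%E.
Proof.
have [->|a0] := eqVneq a 0.
  rewrite enorm0 mul0r integral0_eq// => omega _.
  by rewrite -[0](scale0r 0) dotZl mul0r maxxx.
rewrite (integral_Z_normal a0 (phi := fun x => Num.max x 0)).
- rewrite normal_prob_positive_part; last first.
    apply: divr_gt0; last by rewrite sqrtr_gt0.
    by rewrite lt_def enorm_ge0 andbT; apply: contra_neq a0 => /enorm_eq0.
  have pi2 : 0 <= 2 * pi :> R by rewrite mulr_ge0// pi_ge0.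
  by rewrite (sqrtrM _ pi2) invfM [in RHS]mulrA mulrAC.
- exact: measurable_maxr.
- by move=> x; rewrite le_max lexx orbT.
Qed.

Let measurable_second_diff b g i :
  measurable_fun setT
    (fun omega => second_diff b (Z g omega) (row_of_tuple (V omega) 0 i)).
Proof.
have mY : measurable_fun setT (fun omega => row_of_tuple (V omega) 0 i).
  under eq_fun do rewrite -dot_delta.
  exact: measurable_linear_form.
have mX := measurable_linear_form g.
apply: measurable_funB; last first.
  by apply: measurable_funM => //; exact: (measurableT_comp measurable_sqr_pos).
apply: measurable_funD; apply: (measurableT_comp measurable_sqr_pos).
  by apply: measurable_funD => //; exact: measurable_funM.
by apply: measurable_funB => //; exact: measurable_funM.
Qed.

Let measurable_sqr_pos_Z g : measurable_fun setT (fun omega => sqr_pos (Z g omega)).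
Proof. exact: (measurableT_comp measurable_sqr_pos (measurable_linear_form g)). Qed.

Let sqr_pos_Z_fin g : (\int[P]_omega (sqr_pos (Z g omega))%:E \is a fin_num)%E.
Proof.
rewrite ge0_fin_numE; last by apply: integral_ge0 => omega _; rewrite lee_fin sqr_pos_ge0.
apply: (@le_lt_trans _ _ (enorm g ^+ 2 / p%:R)%:E); last by rewrite ltry.
apply: le_trans (gaussian_linear_form_sqr g); apply: ge0_le_integral => //.
- by move=> omega _; rewrite lee_fin sqr_pos_ge0.
- by apply/measurable_EFinP; exact: measurable_sqr_pos_Z.
- by apply/measurable_EFinP; apply: measurable_funX; exact: measurable_linear_form.
- move=> omega _; rewrite lee_fin.
  have [z0|/ltW z0] := leP 0 (Z g omega); first by rewrite sqr_posE.
  by rewrite sqr_pos_neg// sqr_ge0.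
Qed.

Let row_coord (omega : Omega) i : row_of_tuple (V omega) 0 i = Z (delta_mx 0 i) omega.
Proof. by rewrite /= dot_delta. Qed.

Let integral_second_diffN b g i :
  (\int[P]_omega (second_diff b (Z g omega) (row_of_tuple (V omega) 0 i))%:E =
   \int[P]_omega (second_diff b (Z (- g) omega) (row_of_tuple (V omega) 0 i))%:E)%E.
Proof.
have split_second_diff a :
    (\int[P]_omega (second_diff b (Z a omega) (row_of_tuple (V omega) 0 i))%:E +
     (\int[P]_omega (sqr_pos (Z a omega))%:E + \int[P]_omega (sqr_pos (Z a omega))%:E) =
     \int[P]_omega (sqr_pos (Z (a + b *: delta_mx 0 i) omega))%:E +
     \int[P]_omega (sqr_pos (Z (a - b *: delta_mx 0 i) omega))%:E)%E.
  have posE_ge0 c (omega : Omega) : setT omega -> (0 <= (sqr_pos (Z c omega))%:E)%E.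
    by rewrite lee_fin sqr_pos_ge0.
  have mposE c : measurable_fun setT (fun omega => (sqr_pos (Z c omega))%:E).
    by apply/measurable_EFinP; exact: measurable_sqr_pos_Z.
  have intD c c' :=
    ge0_integralD P measurableT (posE_ge0 c) (mposE c) (posE_ge0 c') (mposE c').
  rewrite -!intD -ge0_integralD//.
  - apply: eq_integral => omega _; rewrite -!EFinD; congr (_%:E).
    rewrite /second_diff dotDl dotBl dotZl row_coord; ring.
  - by move=> omega _; rewrite lee_fin; have /andP[] := second_diff_bounds b (Z a omega)
      (row_of_tuple (V omega) 0 i).
  - by apply/measurable_EFinP; exact: measurable_second_diff.
  - by move=> omega _; rewrite adde_ge0// posE_ge0.
  - exact: emeasurable_funD.
have posN a : (\int[P]_omega (sqr_pos (Z a omega))%:E =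
    \int[P]_omega (sqr_pos (Z (- a) omega))%:E)%E.
  rewrite (gaussian_linear_form_symmetric a measurable_sqr_pos sqr_pos_ge0).
  by apply: eq_integral => omega _; rewrite dotNl.
have cfin : (\int[P]_omega (sqr_pos (Z g omega))%:E +
    \int[P]_omega (sqr_pos (Z g omega))%:E)%E \is a fin_num.
  by rewrite fin_numD sqr_pos_Z_fin.
have eD : - g + b *: delta_mx 0 i = - (g - b *: delta_mx 0 i) :> 'rV[R]_p.
  by rewrite opprB addrC.
have eB : - g - b *: delta_mx 0 i = - (g + b *: delta_mx 0 i) :> 'rV[R]_p.
  by rewrite opprD.
have := split_second_diff (- g); rewrite eD eB -!posN [in RHS]addeC -split_second_diff => H.
by rewrite -[LHS](addeK _ cfin) -[RHS](addeK _ cfin) H.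
Qed.

(** Symmetry is available for single linear forms, while [v_i ^+ 2] has to be
decoupled from the sign of [dot g v].  The product of [2 * v_i ^+ 2] with the
Heaviside function of [dot g v] is the second derivative at [b = 0] of
[sqr_pos (dot (g + b e_i) v)], so the symmetry of the forms [g + b e_i] is
enough: the symmetric second differences in [b] have the same expectation for
[g] and for [- g], they are dominated by [2 * v_i ^+ 2], and the two limits add
up to the full second moment. *)
Lemma gaussian_sign_decoupling g i :
  (\int[P]_omega (row_of_tuple (V omega) 0 i ^+ 2 * heaviside (- Z g omega))%:E
   <= (2 * p%:R)^-1%:E)%E.
Proof.
pose Y omega : R := row_of_tuple (V omega) 0 i.
have mY : measurable_fun setT Y.
  rewrite /Y; under eq_fun do rewrite row_coord.
  exact: measurable_linear_form.
have Y2le : (\int[P]_omega (Y omega ^+ 2)%:E <= (p%:R^-1)%:E)%E.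
  under eq_integral do rewrite /Y row_coord.
  apply: (le_trans (gaussian_linear_form_sqr _)).
  rewrite lee_fin -dotxx dot_delta mxE !eqxx mul1r//.
have mY2 : measurable_fun setT (fun omega => (Y omega ^+ 2)%:E).
  by apply/measurable_EFinP; exact: measurable_funX.
have Y2int : P.-integrable setT (fun omega => (2 * Y omega ^+ 2)%:E).
  under eq_fun do rewrite EFinM.
  apply: integrableZl => //; apply/integrableP; split => //.
  apply: (@le_lt_trans _ _ (p%:R^-1)%:E); last by rewrite ltry.
  apply: le_trans Y2le; apply: ge0_le_integral => //.
    exact: measurableT_comp.
  by move=> omega _; rewrite gee0_abs// lee_fin sqr_ge0.
have cvgJ a : (\int[P]_omega (second_diff k.+1%:R^-1 (Z a omega) (Y omega) *
    k.+1%:R ^+ 2)%:E @[k --> \oo] -->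
    \int[P]_omega (2 * Y omega ^+ 2 * heaviside (Z a omega))%:E)%E.
  apply: (dominated_cvg measurableT _ _ _ Y2int).
  - move=> k; apply/measurable_EFinP; apply: measurable_funM => //.
    exact: measurable_second_diff.
  - move=> omega _; apply/fine_cvgP; split; first exact: nearW.
    exact: second_diff_cvg.
  - by [].
  - move=> k omega _.
    have /andP[l u] := second_diff_bounds k.+1%:R^-1 (Z a omega) (Y omega).
    rewrite gee0_abs ?lee_fin ?mulr_ge0// -ler_pdivlMr ?exprn_gt0//.
    by rewrite (le_trans u)// exprMn exprVn [k in 2 * k]mulrC mulrA.
have mYJ a : measurable_fun setT (fun omega => (Y omega ^+ 2 * heaviside (Z a omega))%:E).
  apply/measurable_EFinP; apply: measurable_funM; first exact: measurable_funX.
  exact: (measurableT_comp measurable_heaviside (measurable_linear_form a)).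
have YJ0 a omega : (0 <= (Y omega ^+ 2 * heaviside (Z a omega))%:E)%E.
  by rewrite lee_fin mulr_ge0 ?sqr_ge0 ?heaviside_ge0.
have intJ2 a : (\int[P]_omega (2 * Y omega ^+ 2 * heaviside (Z a omega))%:E =
    2%:E * \int[P]_omega (Y omega ^+ 2 * heaviside (Z a omega))%:E)%E.
  rewrite -ge0_integralZl_EFin//.
  by apply: eq_integral => omega _; rewrite -mulrA.
have second_diffN k : (\int[P]_omega (second_diff k.+1%:R^-1 (Z g omega) (Y omega) *
      k.+1%:R ^+ 2)%:E =
    \int[P]_omega (second_diff k.+1%:R^-1 (Z (- g) omega) (Y omega) *
      k.+1%:R ^+ 2)%:E)%E.
  have second_diffM a : (\int[P]_omega (second_diff k.+1%:R^-1 (Z a omega) (Y omega) *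
      k.+1%:R ^+ 2)%:E =
      (k.+1%:R ^+ 2)%:E * \int[P]_omega (second_diff k.+1%:R^-1 (Z a omega) (Y omega))%:E)%E.
    rewrite -ge0_integralZl_EFin//.
    - by apply: eq_integral => omega _; rewrite mulrC.
    - move=> omega _; rewrite lee_fin.
      by have /andP[] := second_diff_bounds k.+1%:R^-1 (Z a omega) (Y omega).
    - by apply/measurable_EFinP; exact: measurable_second_diff.
  by rewrite !second_diffM integral_second_diffN.
have JN : (\int[P]_omega (Y omega ^+ 2 * heaviside (Z g omega))%:E =
    \int[P]_omega (Y omega ^+ 2 * heaviside (Z (- g) omega))%:E)%E.
  have cg := cvgJ g; rewrite (eq_fun second_diffN) in cg.
  have H : (2%:E * \int[P]_omega (Y omega ^+ 2 * heaviside (Z g omega))%:E =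
      2%:E * \int[P]_omega (Y omega ^+ 2 * heaviside (Z (- g) omega))%:E)%E.
    by rewrite -!intJ2; apply: (cvg_unique (@ereal_hausdorff R) cg (cvgJ (- g))).
  have le2 (u t : \bar R) : (2%:E * u = 2%:E * t -> u <= t)%E.
    by move=> ut; rewrite -(@lee_pmul2l _ 2%:E)// ut lexx.
  by apply/eqP; rewrite eq_le (le2 _ _ H) (le2 _ _ (esym H)).
have sumJ : (\int[P]_omega (Y omega ^+ 2 * heaviside (Z g omega))%:E +
    \int[P]_omega (Y omega ^+ 2 * heaviside (Z (- g) omega))%:E =
    \int[P]_omega (Y omega ^+ 2)%:E)%E.
  rewrite -ge0_integralD//; apply: eq_integral => omega _.
  rewrite -EFinD -mulrDr dotNl; congr (_%:E).
  rewrite /heaviside oppr_gt0 oppr_eq0.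
  case: (ltrgtP (Z g omega) 0) => _; rewrite ?addr0 ?add0r ?mulr1//.
  by rewrite -[RHS]mulr1 [in RHS](splitr 1) mul1r.
under eq_integral do rewrite -dotNl.
move: sumJ; rewrite JN -mule2n -mule_natl => sumJ.
by rewrite invfM EFinM lee_pdivlMl// sumJ.
Qed.

(** Where [dot g v] is negative the gain is at least [- delta * dot g v - C * |v| ^+ 2],
elsewhere it is nonnegative.  Bringing the quadratic term to the other side keeps
every integrand nonnegative. *)
Lemma gaussian_expected_decrease g (delta C : R) : 0 <= delta -> 0 <= C ->
  ((delta * (enorm g / Num.sqrt (2 * pi * p%:R)))%:E <=
   \int[P]_omega (Num.max
     (- (delta * Z g omega + C * enorm (row_of_tuple (V omega)) ^+ 2)) 0)%:E +
   (C / 2)%:E)%E.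
Proof.
move=> delta0 C0.
pose Y i omega : R := row_of_tuple (V omega) 0 i.
have mY i : measurable_fun setT (Y i).
  rewrite /Y; under eq_fun do rewrite row_coord.
  exact: measurable_linear_form.
pose H i omega := Y i omega ^+ 2 * heaviside (- Z g omega).
have H0 i omega : 0 <= H i omega by rewrite mulr_ge0 ?sqr_ge0 ?heaviside_ge0.
have mH i : measurable_fun setT (H i).
  apply: measurable_funM; first exact: measurable_funX.
  rewrite /=; under eq_fun do rewrite -dotNl.
  exact: (measurableT_comp measurable_heaviside (measurable_linear_form (- g))).
have intH : (\int[P]_omega (C * \sum_(i < p) H i omega)%:E <= (C / 2)%:E)%E.
  under eq_integral do rewrite EFinM.
  rewrite ge0_integralZl_EFin//; first last.
  - by apply/measurable_EFinP; exact: measurable_sum.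
  - by move=> omega _; rewrite lee_fin sumr_ge0.
  rewrite EFinM lee_wpmul2l//.
  under eq_integral do rewrite -sumEFin.
  rewrite ge0_integral_sum//; first last.
  - by move=> i omega _; rewrite lee_fin.
  - by move=> i; exact/measurable_EFinP.
  apply: (@le_trans _ _ (\sum_(i < p) (2 * p%:R)^-1%:E)%E).
    by apply: lee_sum => i _; exact: gaussian_sign_decoupling.
  rewrite sumEFin sumr_const card_ord lee_fin -[leLHS]mulr_natr.
  by rewrite invfM -mulrA mulVf ?mulr1// gt_eqF.
have mdec : measurable_fun setT (fun omega => Num.max
    (- (delta * Z g omega + C * enorm (row_of_tuple (V omega)) ^+ 2)) 0).
  apply: measurable_maxr => //; apply: measurable_funN; apply: measurable_funD.
    by apply: measurable_funM => //; exact: measurable_linear_form.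
  by apply: measurable_funM => //; apply: measurable_funX; exact: measurable_enorm.
apply: le_trans (leeD2l _ intH).
rewrite -ge0_integralD//; first last.
- by apply/measurable_EFinP; apply: measurable_funM => //; exact: measurable_sum.
- by move=> omega _; rewrite lee_fin mulr_ge0// sumr_ge0.
- exact/measurable_EFinP.
- by move=> omega _; rewrite lee_fin le_max lexx orbT.
rewrite -enormN EFinM -(gaussian_linear_form_positive_part (- g)).
rewrite -ge0_integralZl_EFin//; first last.
- apply/measurable_EFinP; apply: measurable_maxr => //.
  exact: measurable_linear_form.
- by move=> omega _; rewrite lee_fin le_max lexx orbT.
apply: ge0_le_integral => //.
- by move=> omega _; rewrite lee_fin mulr_ge0// le_max lexx orbT.
- apply/measurable_EFinP; apply: measurable_funM => //; apply: measurable_maxr => //.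
  exact: measurable_linear_form.
- apply/measurable_EFinP; apply: measurable_funD => //; apply: measurable_funM => //.
  exact: measurable_sum.
move=> omega _; rewrite lee_fin dotNl.
have Hsum : \sum_(i < p) H i omega =
    enorm (row_of_tuple (V omega)) ^+ 2 * heaviside (- Z g omega).
  by rewrite sqr_enorm mulr_suml.
rewrite Hsum; set z := dot g _; set N := enorm _ ^+ 2.
have N0 : 0 <= N by exact: sqr_ge0.
have [z0|z0] := ltP z 0.
  rewrite max_l; last by rewrite oppr_ge0 ltW.
  rewrite /heaviside oppr_gt0 z0 mulr1 mulrN opprD.
  apply: (@le_trans _ _ (- (delta * z) - C * N + C * N)); first by rewrite subrK.
  by rewrite lerD2r le_max lexx.
rewrite max_r ?oppr_le0// mulr0 addr_ge0//; first by rewrite le_max lexx orbT.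
by rewrite mulr_ge0// mulr_ge0// heaviside_ge0.
Qed.

End gaussian_direction.
(** * Independence of the past *)

Section independence.
Local Open Scope ereal_scope.
Context {R : realType} {d : measure_display} {Omega : measurableType d}.
Variable P : probability Omega R.
Context {d' : measure_display} {E : measurableType d'}.

(** The pi-system that generates the sigma-algebra of the variables indexed by [s]. *)
Definition boxes {I : choiceType} (V : I -> Omega -> E) (s : seq I) :
    set (set Omega) :=
  [set A | exists2 B : I -> set E, (forall i, measurable (B i)) &
    A = \bigcap_(i in [set` s]) V i @^-1` B i].

Lemma setI_closed_boxes {I : choiceType} (V : I -> Omega -> E) s :
  setI_closed (boxes V s).
Proof.
move=> _ _ [B mB ->] [C mC ->]; exists (fun i => B i `&` C i).
  by move=> i; exact: measurableI.
by rewrite -bigcapI; apply: eq_bigcapr => i _; rewrite preimage_setI.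
Qed.

Lemma boxes_preimage {I : choiceType} (V : I -> Omega -> E) s i B :
  i \in s -> measurable B -> <<s boxes V s >> (V i @^-1` B).
Proof.
move=> si mB; apply: sub_sigma_algebra.
exists (fun j => if j == i then B else setT); first by move=> j; case: ifP.
apply/seteqP; split=> [omega VB j /= _|omega /(_ i si)/=]; last by rewrite eqxx.
by case: eqP => // ->.
Qed.

(** Independence extends from boxes of past directions to every event that they
generate, by the pi-lambda theorem. *)
Lemma past_independent {I : choiceType} (J : set I)
    (V : I -> {RV P >-> E}) (s : seq I) t :
  mutually_independent J V -> uniq (t :: s) -> {in t :: s, forall i, J i} ->
  forall A, <<s boxes V s >> A -> forall B, measurable B ->
  P (A `&` V t @^-1` B) = P A * P (V t @^-1` B).
Proof.
move=> indep uts Jts.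
have mV i B : measurable B -> measurable (V i @^-1` B).
  by move=> mB; rewrite -[X in measurable X]setTI; exact: measurable_funPT.
pose H := [set A | measurable A /\ forall B, measurable B ->
  P (A `&` V t @^-1` B) = P A * P (V t @^-1` B)].
suff boxH : <<s boxes V s >> `<=` H by move=> A /boxH[].
apply: (lambda_system_subset (@setI_closed_boxes _ V s)) => //; last first.
  move=> _ [B mB ->]; split.
    by apply: fin_bigcap_measurable => // i _; exact: mV.
  move=> C mC.
  have ti i : i \in s -> (i == t) = false.
    by move: uts => /= /andP[ts _] si; apply/negbTE; apply: contraNneq ts => <-.
  pose BC i := if i == t then C else B i.
  have mBC i : measurable (BC i) by rewrite /BC; case: ifP.
  have us : uniq s by move: uts => /andP[].
  have Js : {in s, forall i, J i}.
    by move=> i si; apply: Jts; rewrite in_cons si orbT.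
  have boxE : \bigcap_(i in [set` s]) V i @^-1` B i =
      \bigcap_(i in [set` s]) V i @^-1` BC i.
    by apply: eq_bigcapr => i si; rewrite /BC ti.
  rewrite boxE (indep s us Js _ mBC).
  have := indep _ uts Jts _ mBC; rewrite big_cons {2}/BC eqxx muleC => <-.
  congr (P _); apply/seteqP; split => [omega [H1 H2] i /=|omega H1].
    rewrite in_cons => /orP[/eqP ->|]; first by rewrite /BC eqxx.
    exact: H1.
  split=> [i /= si|]; first by apply: (H1 i); rewrite /= in_cons si orbT.
  by have := H1 t; rewrite /= mem_head /BC eqxx; exact.
apply/dynkin_lambda_system; split.
- split; first exact: measurableT.
  by move=> B mB; rewrite setTI probability_setT mul1e.
- move=> A [mA HA]; split; first exact: measurableC.
  move=> B mB; have mVB := mV t B mB.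
  have PD : P (V t @^-1` B `\` A) = P (V t @^-1` B) - P (V t @^-1` B `&` A).
    by apply: measureD => //; rewrite ltey_eq fin_num_measure.
  rewrite setIC -setDE PD (setIC _ A) HA// probability_setC//.
  by rewrite muleBl ?mul1e ?fin_num_measure.
- move=> F tF HF; have mF k : measurable (F k) by case: (HF k).
  split; first exact: bigcupT_measurable.
  move=> B mB; have mVB := mV t B mB; rewrite setI_bigcupl.
  rewrite measure_semi_bigcup//; first last.
  - by apply: bigcupT_measurable => k; exact: measurableI.
  - exact: trivIset_setIr.
  - by move=> k; exact: measurableI.
  have -> : P (\bigcup_k F k) = \sum_(k <oo) P (F k).
    by apply: measure_semi_bigcup => //; exact: bigcupT_measurable.
  rewrite muleC -(fineK (fin_num_measure P _ mVB)) -nneseriesZl//.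
  apply: eq_eseriesr => k _; rewrite fineK ?fin_num_measure//.
  by have [_ HFk] := HF k; apply: (etrans (HFk B mB)); exact: muleC.
Qed.

End independence.

Section decoupling.
Local Open Scope ereal_scope.
Context {R : realType} {d : measure_display} {Omega : measurableType d}.
Variable P : probability Omega R.
Context {d1 d2 : measure_display} {E1 : measurableType d1} {E2 : measurableType d2}.

(** The joint law is the product law, as it agrees with it on rectangles; Tonelli's
theorem applies. *)
Lemma independent_integral (X : {RV P >-> E1}) (V : {RV P >-> E2})
    (F : E1 * E2 -> \bar R) :
  (forall A B, measurable A -> measurable B ->
    P (X @^-1` A `&` V @^-1` B) = P (X @^-1` A) * P (V @^-1` B)) ->
  measurable_fun setT F -> (forall z, 0 <= F z) ->
  \int[P]_omega F (X omega, V omega) =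
  \int[P]_omega \int[P]_omega' F (X omega, V omega').
Proof.
move=> indep mF F0.
pose XV omega := (X omega, V omega).
have mXV : measurable_fun setT XV by exact: measurable_fun_pair.
pose XVm : {RV P >-> (E1 * E2)%type} :=
  HB.pack XV (isMeasurableFun.Build _ _ _ _ _ mXV).
transitivity (\int[distribution P XVm]_z F z).
  by rewrite ge0_integral_distribution.
transitivity (\int[distribution P X \x distribution P V]_z F z).
  apply: eq_measure_integral => A mA _.
  by apply/esym; apply: (@product_measure_unique _ _ _ _ _ (distribution P X)
    (distribution P V) (distribution P XVm)).
transitivity (\int[distribution P X]_x \int[distribution P V]_z F (x, z)).
  exact: (@fubini_tonelli1 _ _ _ _ _ (distribution P X) (distribution P V)).
rewrite ge0_integral_distribution//; first last.
- by move=> x; apply: integral_ge0.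
- exact: (measurable_fun_fubini_tonelli_F (m2 := distribution P V)).
apply: eq_integral => omega _ /=; rewrite ge0_integral_distribution//.
exact: measurableT_comp.
Qed.

End decoupling.

(** * One step of the search *)

Section pathwise.
Context {R : realType} {n p q r : nat}.
Variables (f : 'rV[R]_n -> 'rV[R]_p -> 'rV[R]_r -> 'rV[R]_n).
Variables (h : 'rV[R]_n -> 'rV[R]_r -> 'rV[R]_q) (w : nat -> 'rV[R]_r).
Variables (Lfx Lfw Lhx Lhw : R) (xss : 'rV[R]_p -> 'rV[R]_r -> 'rV[R]_n).
Hypothesis hLfx : 0 < Lfx < 1.
Hypothesis hLhx : 0 <= Lhx.
Hypothesis hfx : forall u w', elipschitz Lfx (fun x => f x u w').
Hypothesis hfw : forall x u, elipschitz Lfw (fun w' => f x u w').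
Hypothesis hhx : forall w', elipschitz Lhx (fun x => h x w').
Hypothesis hhw : forall x, elipschitz Lhw (fun w' => h x w').
Hypothesis hxss : steady_state_map f xss.
Variables (Psi : 'rV[R]_p -> 'rV[R]_q -> R) (LPsi L : R).
Hypothesis hLPsi : 0 <= LPsi.
Hypothesis hPsi : forall u y y', `|Psi u y - Psi u y'| <= LPsi * enorm (y - y').

Let Lyssw := Lhw + Lhx * Lfw / (1 - Lfx).
Let Phi := reduced_cost h Psi xss w.

Hypothesis hdiff : forall t u, differentiable (Phi t) u.
Hypothesis hgrad : forall t, elipschitz L (gradient (Phi t)).

Lemma reduced_cost_drift t u :
  `|Phi t.+1 u - Phi t u| <= LPsi * (Lyssw * enorm (w t.+1 - w t)).
Proof.
rewrite (le_trans (hPsi _ _ _))// ler_wpM2l//.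
exact: (steady_output_lipschitz hLfx hLhx hfx hfw hhx hhw hxss).
Qed.

Lemma measured_cost_error t u y m :
  enorm (y - steady_output h xss u (w t)) <= m ->
  `|Psi u y - Phi t u| <= LPsi * m.
Proof. by move=> ym; rewrite (le_trans (hPsi _ _ _))// ler_wpM2l. Qed.

(** Whatever the comparison of the measured costs decides, the retained input is,
up to the measurement errors and the drift, at least as good as both candidates;
the descent lemma bounds the better of the two. *)
Lemma search_step_decrease (delta : nat -> R) u0 x0 v u x y t mt mt1 :
  two_point_search f h Psi w delta u0 x0 v u x y -> ~~ odd t ->
  enorm (y t.+1 - steady_output h xss (u t) (w t)) <= mt ->
  enorm (y t.+2 - steady_output h xss (u t.+1) (w t.+1)) <= mt1 ->
  Phi t.+2 (u t.+2) + Num.max (- (delta t * dot (gradient (Phi t) (u t)) (v t) +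
    L / 2 * delta t ^+ 2 * enorm (v t) ^+ 2)) 0 <=
  Phi t (u t) + (LPsi * (mt + mt1) +
    2 * LPsi * Lyssw * (enorm (w t.+1 - w t) + enorm (w t.+2 - w t.+1))).
Proof.
move=> S et /measured_cost_error + /measured_cost_error.
set d0 := enorm (w t.+1 - w t); set d1 := enorm (w t.+2 - w t.+1).
have d0_ge0 : 0 <= LPsi * (Lyssw * d0).
  by rewrite (le_trans _ (reduced_cost_drift t 0)).
have d1_ge0 : 0 <= LPsi * (Lyssw * d1).
  by rewrite (le_trans _ (reduced_cost_drift t.+1 0)).
have D01 := reduced_cost_drift t (u t.+1); rewrite -/d0 in D01.
have D02 := reduced_cost_drift t (u t.+2); rewrite -/d0 in D02.
have D12 := reduced_cost_drift t.+1 (u t.+2); rewrite -/d1 in D12.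
have desc := descent (hdiff t) (hgrad t) (u t) (delta t *: v t).
move: desc; rewrite -(search_probe S et) dotZr enormZ exprMn real_normK ?num_real//.
rewrite mulrA => desc e0 e1.
have maxE : Phi t (u t) - Num.max (- (delta t * dot (gradient (Phi t) (u t)) (v t) +
    L / 2 * delta t ^+ 2 * enorm (v t) ^+ 2)) 0 >=
    Num.min (Phi t (u t)) (Phi t (u t.+1)).
  rewrite /Num.max; case: ifP => _; rewrite ?subr0 ge_min ?lexx//.
  by apply/orP; right; lra.
have sel := search_select S et.
move: D01 D02 D12 e0 e1; rewrite !ler_norml.
move=> /andP[? ?] /andP[? ?] /andP[? ?] /andP[? ?] /andP[? ?].
have best : Phi t (u t.+2) <= Num.min (Phi t (u t)) (Phi t (u t.+1)) +
    LPsi * (mt + mt1) + LPsi * (Lyssw * d0).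
  rewrite sel; have [acc|/ltW rej] := leP (Psi (u t.+1) (y t.+2)) (Psi (u t) (y t.+1)).
    by rewrite /Num.min; case: ifP => _; lra.
  by rewrite /Num.min; case: ifP => _; lra.
by move: maxE best; lra.
Qed.

End pathwise.

Section random_gradient.
Local Open Scope ereal_scope.
Context {R : realType} {d : measure_display} {Omega : measurableType d}.
Variable P : probability Omega R.
Context {p : nat} (hp : (0 < p)%N) {I : choiceType}.
Variables (J : set I) (v : I -> {RV P >-> p.-tuple R}) (s : seq I) (t : I).
Hypothesis hvt : normal_vector 0 (p%:R^-1)%:M (v t).
Hypothesis hindep : mutually_independent J v.
Hypotheses (uts : uniq (t :: s)) (Jts : {in t :: s, forall i, J i}).

Local Notation past := (g_sigma_algebraType (boxes (fun i => v i) s)).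

Lemma past_measurable A : <<s boxes (fun i => v i) s >> A -> d.-measurable A.
Proof.
apply: smallest_sub; first exact: sigma_algebra_measurable.
move=> _ [B mB ->]; apply: fin_bigcap_measurable => // i _.
by rewrite -[X in measurable X]setTI; exact: measurable_funPT.
Qed.

Lemma past_measurable_row i : i \in s ->
  measurable_row (fun omega : past => row_of_tuple (v i omega)).
Proof.
move=> si j _ Y mY; rewrite setTI.
rewrite (_ : _ @^-1` Y = v i @^-1` ((fun z => tnth z j) @^-1` Y)); last first.
  by apply/seteqP; split => omega /=; rewrite mxE.
apply: boxes_preimage => //; rewrite -[X in measurable X]setTI.
exact: measurable_tnth.
Qed.

(** Conditionally on the past the vector [G] is a constant, and the bound for a
fixed vector is integrated over its values. *)
Lemma random_gradient_expected_decrease (G : Omega -> 'rV[R]_p) (delta C : R) :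
  @measurable_row _ _ past _ G -> (0 <= delta)%R -> (0 <= C)%R ->
  (delta / Num.sqrt (2 * pi * p%:R))%:E * \int[P]_omega (enorm (G omega))%:E <=
  \int[P]_omega (Num.max (- (delta * dot (G omega) (row_of_tuple (v t omega)) +
    C * enorm (row_of_tuple (v t omega)) ^+ 2)) 0)%:E + (C / 2)%:E.
Proof.
move=> mG delta0 C0.
have mG' : measurable_row G.
  by move=> j _ Y mY; rewrite setTI; apply: past_measurable;
    rewrite -[X in _ X]setTI; exact: mG.
pose X omega := [tuple (G omega 0 i)%R | i < p].
have XK omega : row_of_tuple (X omega) = G omega.
  by apply/rowP => j; rewrite mxE tnth_mktuple.
have mX : measurable_fun setT X.
  apply/measurable_fun_tnthP => j; rewrite (_ : _ \o _ = fun omega => (G omega 0 j)%R).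
    exact: mG'.
  by apply/funext => omega /=; rewrite tnth_mktuple.
have mXp : measurable_fun setT (X : past -> p.-tuple R).
  apply/measurable_fun_tnthP => j; rewrite (_ : _ \o _ = fun omega => (G omega 0 j)%R).
    exact: mG.
  by apply/funext => omega /=; rewrite tnth_mktuple.
pose Xm : {RV P >-> p.-tuple R} := HB.pack X (isMeasurableFun.Build _ _ _ _ _ mX).
pose F (z : p.-tuple R * p.-tuple R) := (Num.max
  (- (delta * dot (row_of_tuple z.1) (row_of_tuple z.2) +
    C * enorm (row_of_tuple z.2) ^+ 2)) 0)%:E.
have mrow (pr : p.-tuple R * p.-tuple R -> p.-tuple R) :
    measurable_fun setT pr -> measurable_row (fun z => row_of_tuple (pr z)).
  move=> mpr j; under eq_fun do rewrite mxE.
  exact: (measurableT_comp (measurable_tnth j) mpr).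
have mF : measurable_fun setT F.
  have m1 := mrow _ measurable_fst; have m2 := mrow _ measurable_snd.
  apply/measurable_EFinP; apply: measurable_maxr => //.
  apply: measurable_funN; apply: measurable_funD.
    apply: measurable_funM => //; apply: measurable_sum => j.
    by apply: measurable_funM; [exact: m1|exact: m2].
  by apply: measurable_funM => //; apply: measurable_funX; exact: measurable_enorm.
have F0 z : 0 <= F z by rewrite lee_fin le_max lexx orbT.
have -> : \int[P]_omega (Num.max (- (delta * dot (G omega) (row_of_tuple (v t omega)) +
    C * enorm (row_of_tuple (v t omega)) ^+ 2)) 0)%:E =
    \int[P]_omega F (Xm omega, v t omega).
  by apply: eq_integral => omega _; rewrite /F /= XK.
rewrite (independent_integral _ mF F0); last first.
  move=> A B mA mB; apply: (past_independent hindep uts Jts) => //.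
  by rewrite -[X in _ X]setTI; exact: mXp.
have mFint : measurable_fun setT
    (fun omega => \int[P]_omega' F (Xm omega, v t omega')).
  have mFv : measurable_fun setT
      (fun z : p.-tuple R * Omega => F (z.1, v t z.2)).
    by apply: measurableT_comp => //; apply: measurable_fun_pair => //;
      exact: measurableT_comp.
  have mI := measurable_fun_fubini_tonelli_F (m2 := P) _ mFv (fun z => F0 _).
  exact: (measurableT_comp mI mX).
have menorm : measurable_fun setT (fun omega => (enorm (G omega))%:E).
  by apply/measurable_EFinP; exact: measurable_enorm.
rewrite -ge0_integralZl_EFin//; first last.
- by rewrite divr_ge0.
- by move=> omega _; rewrite lee_fin enorm_ge0.
rewrite -[(C / 2)%:E]mule1 -(probability_setT P) -integral_cst//.
rewrite -ge0_integralD//; first last.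
- by move=> omega _; rewrite lee_fin divr_ge0.
- by move=> omega _; apply: integral_ge0.
apply: ge0_le_integral => //.
- by move=> omega _; rewrite mule_ge0// lee_fin ?divr_ge0 ?enorm_ge0.
- exact: measurable_funeM.
- by apply: emeasurable_funD.
move=> omega _ /=; rewrite -EFinM mulrAC -mulrA.
apply: le_trans (gaussian_expected_decrease hp hvt (G omega) delta0 C0) _.
by rewrite leeD2r// /F /= XK.
Qed.

End random_gradient.

(** * Summation over the steps *)

Lemma big_even_recr (T : Type) (idx : T) (op : Monoid.law idx) (F : nat -> T) k :
  \big[op/idx]_(0 <= t < k.+1.*2 | ~~ odd t) F t =
  op (\big[op/idx]_(0 <= t < k.*2 | ~~ odd t) F t) (F k.*2).
Proof.
rewrite doubleS 2!big_mkcond !big_nat_recr//= odd_double/=.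
by rewrite Monoid.mulm1 -big_mkcond.
Qed.

(** One step of the summation: [a] and [a'] are the expected gaps to the lower bound
before and after the step, [b] is its expected gain and [c] the sum so far. *)
Lemma lee_telescope {R : realDomainType} (a a' b c g l e x : \bar R) :
  (a' + b <= a + e -> g <= b + l -> a + c <= x -> a' + (c + g) <= x + (e + l))%E.
Proof.
move=> ab gl ac; apply: le_trans (leeD2l _ (leeD2l _ gl)) _.
rewrite !addeA [leLHS](ACl (1*3*(2*4)))/=.
apply: le_trans (leeD2r _ ab) _.
rewrite !addeA [leLHS](ACl (1*3*2*4))/= -!addeA addeA.
exact: leeD2r.
Qed.

Theorem corollary4p10 (R : realType) (n p q r : nat) (hp : (0 < p)%N)
    (* plant *)
    (f : 'rV[R]_n -> 'rV[R]_p -> 'rV[R]_r -> 'rV[R]_n)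
    (h : 'rV[R]_n -> 'rV[R]_r -> 'rV[R]_q)
    (w : nat -> 'rV[R]_r)
    (Lfx Lfu Lfw Lhx Lhw : R)
    (hLfx : 0 < Lfx < 1) (hLfu : 0 <= Lfu) (hLfw : 0 <= Lfw)
    (hLhx : 0 <= Lhx) (hLhw : 0 <= Lhw)
    (hfx : forall u w', elipschitz Lfx (fun x => f x u w'))
    (hfu : forall x w', elipschitz Lfu (fun u => f x u w'))
    (hfw : forall x u, elipschitz Lfw (fun w' => f x u w'))
    (hhx : forall w', elipschitz Lhx (fun x => h x w'))
    (hhw : forall x, elipschitz Lhw (fun w' => h x w'))
    (xss : 'rV[R]_p -> 'rV[R]_r -> 'rV[R]_n)
    (hxss : steady_state_map f xss)
    (* cost *)
    (Psi : 'rV[R]_p -> 'rV[R]_q -> R)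
    (LPsi L Philow : R)
    (hLPsi : 0 <= LPsi) (hL : 0 < L)
    (hPsi : forall u y y', `|Psi u y - Psi u y'| <= LPsi * enorm (y - y'))
    (hdiff : forall t u, differentiable (reduced_cost h Psi xss w t) u)
    (hgrad : forall t, elipschitz L (gradient (reduced_cost h Psi xss w t)))
    (hlow : forall t u, Philow <= reduced_cost h Psi xss w t u)
    (hcont : forall x t, continuous (fun u => Psi u (h (f x u (w t)) (w t))))
    (* random directions *)
    (d : measure_display) (Omega : measurableType d) (P : probability Omega R)
    (v : nat -> {RV P >-> p.-tuple R})
    (hv : forall t, ~~ odd t -> normal_vector 0 (p%:R^-1)%:M (v t))
    (hindep : mutually_independent [set t | ~~ odd t] v)
    (* iterates *)
    (delta : nat -> R) (hdelta : forall t, ~~ odd t -> 0 < delta t)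
    (u0 : 'rV[R]_p) (x0 : 'rV[R]_n)
    (u : nat -> Omega -> 'rV[R]_p) (x : nat -> Omega -> 'rV[R]_n)
    (y : nat -> Omega -> 'rV[R]_q)
    (hsearch : forall omega,
      two_point_search f h Psi w delta u0 x0
        (fun t => row_of_tuple (v t omega))
        (u^~ omega) (x^~ omega) (y^~ omega))
    (* transient errors *)
    (mu : nat -> {RV P >-> R}) (hmu0 : forall t omega, 0 <= mu t omega)
    (hmu : forall t, {ae P, forall omega,
      enorm (y t.+1 omega - steady_output h xss (u t omega) (w t))
        <= mu t omega}) :
  let Lyssw := Lhw + Lhx * Lfw / (1 - Lfx) in
  let Phi := reduced_cost h Psi xss w in
  let gradnorm t := fun omega => enorm (gradient (Phi t) (u t omega)) in
  forall T : nat, ~~ odd T -> (2 <= T)%N ->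
  let bound :=
    ((Phi 0%N u0 - Philow
      + L / 4 * (\sum_(0 <= t < T | ~~ odd t) delta t ^+ 2)
      + 2 * LPsi * Lyssw * (\sum_(0 <= t < T) enorm (w t.+1 - w t)))%:E
     + (2 * LPsi)%:E * (\sum_(0 <= t < T) 'E_P[mu t]))%E in
  ((Num.sqrt (2 * pi * p%:R))^-1%:E
     * (\sum_(0 <= t < T | ~~ odd t) (delta t)%:E * 'E_P[gradnorm t])
     <= bound)%E
  /\
  (\big[Order.min/+oo]_(0 <= t < T | ~~ odd t) 'E_P[gradnorm t]
     <= (Num.sqrt (2 * pi * p%:R)
         / (\sum_(0 <= t < T | ~~ odd t) delta t))%:E * bound)%E.
Proof.
move=> Lyssw Phi gradnorm T evenT T2 bound.
pose c : R := Num.sqrt (2 * pi * p%:R).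
have c0 : 0 < c by rewrite sqrtr_gt0 !mulr_gt0 ?pi_gt0// ltr0n.
have Lyssw0 : 0 <= Lyssw.
  by rewrite addr_ge0// divr_ge0 ?mulr_ge0// subr_ge0 ltW//; case/andP: hLfx.
pose past k := [seq j.*2 | j <- iota 0 k].
have past_lt k t : t \in past k -> ~~ odd t /\ (t < k.*2)%N.
  by move=> /mapP[j]; rewrite mem_iota => /andP[_ jk] ->; rewrite odd_double ltn_double.
have mem_past k j : (j < k)%N -> j.*2 \in past k.
  by move=> jk; apply: map_f; rewrite mem_iota.
have uniq_past k : uniq (k.*2 :: past k).
  rewrite /= map_inj_uniq ?iota_uniq ?andbT; last exact: double_inj.
  by apply/negP => /past_lt[_]; rewrite ltnn.
have past_even k : {in k.*2 :: past k, forall t, [set t | ~~ odd t] t}.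
  by move=> t; rewrite in_cons => /predU1P[->|/past_lt[]//]; rewrite /= odd_double.
have mgrad d' (Omega' : measurableType d') (U : Omega' -> 'rV[R]_p) t :
    measurable_row U -> measurable_row (fun omega => gradient (Phi t) (U omega)).
  move=> mU j.
  apply: (measurable_continuous_row (g := fun a => gradient (Phi t) a 0 j)) => //.
  apply: (@enorm_continuous _ _ L) => a b.
  have := coord_le_enorm (gradient (Phi t) a - gradient (Phi t) b) j.
  by rewrite !mxE => /le_trans; apply; exact: hgrad.
(* measurability with respect to the earlier directions is what makes the input
   at time 2 k independent of the next direction *)
have mu_past k : @measurable_row _ _ (g_sigma_algebraType (boxes (fun i => v i) (past k)))
    _ (u k.*2).
  have := @measurable_search _ _ _ _ _ f h w _ _ _ _ hLhx hfx hfu hhx _ hLPsi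
    hPsi hcont _ (g_sigma_algebraType (boxes (fun i => v i) (past k))) _ _ _ _
    _ _ _ hsearch k.
  by case=> // s sk; apply: past_measurable_row; exact: mem_past.
have mu_row k : measurable_row (u k.*2).
  move=> j _ Y mY; rewrite setTI; apply: (@past_measurable _ _ _ P _ _ v (past k)).
  by rewrite -[X in _ X]setTI; exact: mu_past.
pose gap k omega := Phi k.*2 (u k.*2 omega) - Philow.
have gap0 k omega : 0 <= gap k omega by rewrite subr_ge0 hlow.
have mgap k : measurable_fun setT (fun omega => (gap k omega)%:E).
  apply/measurable_EFinP; apply: measurable_funB => //.
  apply: (measurable_continuous_row (g := Phi k.*2)) => // a.
  exact: differentiable_continuous.
pose V t omega := row_of_tuple (v t omega).
pose gain t omega : R := Num.max (- (delta t * dot (gradient (Phi t) (u t omega))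
  (V t omega) + L / 2 * delta t ^+ 2 * enorm (V t omega) ^+ 2)) 0.
have gain0 t omega : 0 <= gain t omega by rewrite le_max lexx orbT.
have mV t : measurable_row (V t).
  move=> j; rewrite /V; under eq_fun do rewrite mxE.
  exact: (measurableT_comp (measurable_tnth j)).
have mgain k : measurable_fun setT (fun omega => (gain k.*2 omega)%:E).
  apply/measurable_EFinP; apply: measurable_maxr => //.
  apply: measurable_funN; apply: measurable_funD.
    apply: measurable_funM => //; apply: measurable_sum => j.
    by apply: measurable_funM; [exact: mgrad|exact: mV].
  by apply: measurable_funM => //; apply: measurable_funX; exact: measurable_enorm.
pose drift t := enorm (w t.+1 - w t).
(* the quadratic coefficient of the gain is C = L / 2 * delta ^+ 2, and half of C
   is lost in expectation *)
have gain_ge k : ((delta k.*2 / c)%:E * 'E_P[gradnorm k.*2] <=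
    \int[P]_omega (gain k.*2 omega)%:E + (L / 4 * delta k.*2 ^+ 2)%:E)%E.
  rewrite unlock (_ : L / 4 * _ = L / 2 * delta k.*2 ^+ 2 / 2); last by field.
  apply: (@random_gradient_expected_decrease _ _ _ _ _ hp _ [set t | ~~ odd t] v
    (past k)) => //.
  - by apply: hv; rewrite odd_double.
  - exact: mgrad.
  - by rewrite ltW// hdelta// odd_double.
  - by rewrite mulr_ge0 ?sqr_ge0// divr_ge0// ltW.
have Emu t : ('E_P[mu t] = \int[P]_omega (mu t omega)%:E)%E by rewrite unlock.
(* the pathwise estimate holds outside a null set, where both transient bounds
   are available *)
have step_le k : (\int[P]_omega (gap k.+1 omega)%:E +
    \int[P]_omega (gain k.*2 omega)%:E <=
    \int[P]_omega (gap k omega)%:E + (LPsi%:E * ('E_P[mu k.*2] + 'E_P[mu k.*2.+1]) +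
      (2 * LPsi * Lyssw * (drift k.*2 + drift k.*2.+1))%:E))%E.
  have ek : ~~ odd k.*2 by rewrite odd_double.
  have mmu t : measurable_fun setT (fun omega => (mu t omega)%:E).
    exact/measurable_EFinP.
  have muE0 t omega : (0 <= (mu t omega)%:E)%E by rewrite lee_fin.
  rewrite -ge0_integralD//; first last.
  - by move=> omega _; rewrite lee_fin.
  - by move=> omega _; rewrite lee_fin.
  rewrite !Emu -ge0_integralD// -ge0_integralZl_EFin//; first last.
  - exact: emeasurable_funD.
  - by move=> omega _; rewrite adde_ge0.
  have K0 : 0 <= 2 * LPsi * Lyssw * (drift k.*2 + drift k.*2.+1).
    by rewrite !mulr_ge0// addr_ge0 ?enorm_ge0.
  rewrite -[(2 * _ * _ * _)%:E]mule1 -(probability_setT P) -integral_cst//.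
  have mmu2 : measurable_fun setT (fun omega =>
      LPsi%:E * ((mu k.*2 omega)%:E + (mu k.*2.+1 omega)%:E))%E.
    by apply: measurable_funeM; exact: emeasurable_funD.
  have mu20 omega : (0 <= LPsi%:E * ((mu k.*2 omega)%:E + (mu k.*2.+1 omega)%:E))%E.
    by rewrite mule_ge0// adde_ge0.
  rewrite -ge0_integralD// -ge0_integralD//; first last.
  - exact: emeasurable_funD.
  - by move=> omega _; rewrite adde_ge0.
  - by move=> omega _; rewrite lee_fin.
  apply: ae_ge0_le_integral => //.
  - by move=> omega _; rewrite adde_ge0// lee_fin.
  - exact: emeasurable_funD.
  - move=> omega _; apply: adde_ge0; first by rewrite lee_fin.
    by apply: adde_ge0 => //; rewrite lee_fin.
  - by apply: emeasurable_funD => //; exact: emeasurable_funD.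
  apply: filterS2 (hmu k.*2) (hmu k.*2.+1) => omega mu0_ mu1_ _.
  rewrite /= -!EFinD lee_fin /gap /gain doubleS.
  have := search_step_decrease hLfx hLhx hfx hfw hhx hhw hxss hLPsi hPsi
    hdiff hgrad (hsearch omega) ek mu0_ mu1_.
  rewrite -/Phi -/Lyssw -/(drift _) -/(drift _).
  by rewrite -/(V _ _); lra.
have sum_le k : (\int[P]_omega (gap k omega)%:E +
    \sum_(0 <= t < k.*2 | ~~ odd t) (delta t / c)%:E * 'E_P[gradnorm t] <=
    (Phi 0%N u0 - Philow + L / 4 * (\sum_(0 <= t < k.*2 | ~~ odd t) delta t ^+ 2) +
      2 * LPsi * Lyssw * (\sum_(0 <= t < k.*2) drift t))%:E +
    LPsi%:E * (\sum_(0 <= t < k.*2) 'E_P[mu t]))%E.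
  elim: k => [|k IH].
    rewrite double0 !big_geq// mulr0 !mulr0 !addr0 mule0 !adde0.
    rewrite /gap double0; under eq_integral do rewrite (search_input0 (hsearch _)).
    by rewrite integral_cst// [X in (_ * X)%E](probability_setT P) mule1.
  rewrite !big_even_recr doubleS !big_nat_recr//=.
  set A := (\sum_(0 <= t < k.*2 | _) _)%E in IH *.
  set M := (\sum_(0 <= t < k.*2) 'E_P[_])%E in IH *.
  set m0 := ('E_P[mu k.*2])%E in step_le *; set m1 := ('E_P[mu k.*2.+1])%E in step_le *.
  set S := \sum_(0 <= t < k.*2 | _) _ in IH *.
  set Dr := \sum_(0 <= t < k.*2) _ in IH *.
  have M0 : (0 <= M)%E by apply: sume_ge0 => t _; exact: expectation_ge0.
  have m00 : (0 <= m0)%E by exact: expectation_ge0.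
  have m10 : (0 <= m1)%E by exact: expectation_ge0.
  apply: le_trans (lee_telescope (step_le k) (gain_ge k) IH) _.
  have -> : (LPsi%:E * (M + m0 + m1) = LPsi%:E * M + LPsi%:E * (m0 + m1))%E.
    by rewrite -addeA ge0_muleDr// adde_ge0.
  rewrite le_eqVlt; apply/orP; left; apply/eqP.
  set z := (LPsi%:E * (m0 + m1))%E; set z' := (LPsi%:E * M)%E.
  rewrite (_ : _ + L / 4 * (S + _) + 2 * LPsi * Lyssw * (Dr + _ + _) =
    (Phi 0%N u0 - Philow + L / 4 * S + 2 * LPsi * Lyssw * Dr) +
    2 * LPsi * Lyssw * (drift k.*2 + drift k.*2.+1) + L / 4 * delta k.*2 ^+ 2);
    last by ring.
  rewrite 2!(EFinD (_ + _)).
  have AC5 (a1 a2 a3 a4 a5 : \bar R) :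
      (a1 + a2 + (a3 + a4 + a5) = a1 + a4 + a5 + (a2 + a3))%E.
    by rewrite !addeA [LHS](ACl (1*4*5*2*3)).
  exact: AC5.
have gap_le k : (\sum_(0 <= t < k.*2 | ~~ odd t) (delta t / c)%:E * 'E_P[gradnorm t] <=
    (Phi 0%N u0 - Philow + L / 4 * (\sum_(0 <= t < k.*2 | ~~ odd t) delta t ^+ 2) +
      2 * LPsi * Lyssw * (\sum_(0 <= t < k.*2) drift t))%:E +
    (2 * LPsi)%:E * (\sum_(0 <= t < k.*2) 'E_P[mu t]))%E.
  apply: le_trans (le_trans _ (sum_le k)) _.
    by rewrite leeDr// integral_ge0// => omega _; rewrite lee_fin.
  rewrite leeD2l// lee_wpmul2r ?lee_fin//; last lra.
  by apply: sume_ge0 => t _; exact: expectation_ge0.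
have TE : T = T./2.*2 by rewrite -{1}(odd_double_half T) (negPf evenT).
have Egrad0 t : (0 <= 'E_P[gradnorm t])%E.
  by apply: expectation_ge0 => omega; exact: enorm_ge0.
have main : ((Num.sqrt (2 * pi * p%:R))^-1%:E *
    (\sum_(0 <= t < T | ~~ odd t) (delta t)%:E * 'E_P[gradnorm t]) <= bound)%E.
  rewrite -/c ge0_sume_distrr; last first.
    by move=> t et; rewrite mule_ge0// lee_fin ltW// hdelta.
  apply: le_trans _ (le_trans (gap_le T./2) _); last by rewrite -TE.
  rewrite -TE le_eqVlt; apply/orP; left; apply/eqP; apply: eq_bigr => t _.
  by rewrite muleA -EFinM mulrC.
split=> //.
set S := \sum_(_ <= _ < _ | _) _.
have S0 : 0 < S.
  rewrite /S big_mkcond/= big_ltn ?(ltn_trans _ T2)//= ltr_pwDl ?hdelta//.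
  by apply: sumr_ge0 => t _; case: ifPn => // et; rewrite ltW// hdelta.
rewrite -/c -[c / S]invf_div lee_pdivlMl ?divr_gt0//.
apply: le_trans main; rewrite -/c mulrC EFinM -muleA lee_pmul2l//; last first.
  by rewrite lte_fin invr_gt0.
rewrite /S -sumEFin ge0_sume_distrl; last first.
  by move=> t et; rewrite lee_fin ltW// hdelta.
rewrite big_seq_cond [leRHS]big_seq_cond; apply: lee_sum => t /andP[tT et].
rewrite lee_pmul2l ?lte_fin ?hdelta//.
exact: ge_bigmin_seq.
Qed.
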